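(* Let $\mathcal{F}$ be a finite subcollection of $\mathcal{M}(\mathbb{D})$ and suppose $\gamma_f<1$ for each $f\in\mathcal{F}$. If the tangency graph $T(\mathcal{F})$ contains a cycle, then $$\dim \Lambda(\mathcal{F})=\frac{\log\rho(\mathcal{F})}{\log|\mathcal{F}|},$$ and otherwise $\dim\Lambda(\mathcal{F})=0$.
   Context: $\mathbb{D}$ is the open unit disc; $\mathcal{M}(\mathbb{D})$ is the set of Möbius transformations $f$ with $f(\mathbb{D})\subset\mathbb{D}$, $f(\mathbb{D})\neq\mathbb{D}$. For $f\in\mathcal{M}(\mathbb{D})$: if $f(\mathbb{D})$ is internally tangent to $\mathbb{D}$ (at a unique point), $\alpha_f,\beta_f\in\partial\mathbb{D}$ are the unique points with $f(\alpha_f)=\beta_f$; otherwise $\alpha_f=0$, $\beta_f=\infty$. Set $\gamma_f=1/|f'(\alpha_f)|$. The tangency graph $T(\mathcal{F})$ is the directed graph with vertex set $\mathcal{F}$ and a directed edge from $f$ to $g$ iff $\alpha_f=\beta_g$. A cycle is a sequence of vertices $x_0,\dots,x_n$ ($n\ge1$) with $x_0=x_n$ and a directed edge from $x_{i-1}$ to $x_i$ for each $i$. $\rho(\mathcal{F})$ is the spectral radius of the adjacency matrix of $T(\mathcal{F})$. $\Omega(\mathcal{F})$ is the set of all sequences $(f_n)_{n\ge1}$ with $f_n\in\mathcal{F}$, with metric $d((f_n),(g_n))=|\mathcal{F}|^{-k}$ where $k=\min\{i: f_i\neq g_i\}$ (and $d=0$ if the sequences are equal). $\Lambda(\mathcal{F})\subset\Omega(\mathcal{F})$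 is the set of sequences $(f_n)$ for which the composition sequence $F_n=f_1\cdots f_n$ is of limit-disc type, i.e. $\bigcap_n F_n(\overline{\mathbb{D}})$ is a closed disc of positive radius rather than a point. $\dim$ denotes Hausdorff dimension with respect to $d$. *)

(* Defs.v *)
From Stdlib Require Import Reals List ClassicalEpsilon.
Open Scope R_scope.

Definition C : Type := (R * R)%type.
Definition C0 : C := (0, 0).
Definition C1 : C := (1, 0).
Definition RtoC (x : R) : C := (x, 0).
Definition Cadd (z w : C) : C := (fst z + fst w, snd z + snd w).
Definition Copp (z : C) : C := (- fst z, - snd z).
Definition Csub (z w : C) : C := Cadd z (Copp w).
Definition Cmul (z w : C) : C :=
  (fst z * fst w - snd z * snd w, fst z * snd w + snd z * fst w).
Definition Cinv (z : C) : C :=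
  (fst z / (fst z ^ 2 + snd z ^ 2), - snd z / (fst z ^ 2 + snd z ^ 2)).
Definition Cdiv (z w : C) : C := Cmul z (Cinv w).
Definition Cnorm (z : C) : R := sqrt (fst z ^ 2 + snd z ^ 2).

Record Mob := mkMob { ma : C; mb : C; mc : C; md : C }.

Definition mob_det (f : Mob) : C := Csub (Cmul (ma f) (md f)) (Cmul (mb f) (mc f)).

Definition mob_eval (f : Mob) (z : C) : C :=
  Cdiv (Cadd (Cmul (ma f) z) (mb f)) (Cadd (Cmul (mc f) z) (md f)).

Definition mob_deriv (f : Mob) (z : C) : C :=
  Cdiv (mob_det f) (Cmul (Cadd (Cmul (mc f) z) (md f)) (Cadd (Cmul (mc f) z) (md f))).

Definition mob_id : Mob := mkMob C1 C0 C0 C1.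

(* f is in M(D): a genuine Moebius map (ad - bc <> 0), f(D) ⊂ D (in particular
   no pole in D), and f(D) <> D. *)
Definition in_MD (f : Mob) : Prop :=
  mob_det f <> C0 /\
  (forall z, Cnorm z < 1 ->
     Cadd (Cmul (mc f) z) (md f) <> C0 /\ Cnorm (mob_eval f z) < 1) /\
  (exists w, Cnorm w < 1 /\ forall z, Cnorm z < 1 -> mob_eval f z <> w).

(* f(D) is internally tangent to D: some boundary point is mapped to the boundary *)
Definition tangent (f : Mob) : Prop :=
  exists z, Cnorm z = 1 /\ Cnorm (mob_eval f z) = 1.

(* alpha_f : the (unique) tangency preimage, or 0 *)
Definition alpha (f : Mob) : C :=
  if excluded_middle_informative (tangent f)
  then epsilon (inhabits C0) (fun z => Cnorm z = 1 /\ Cnorm (mob_eval f z) = 1)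
  else C0.

(* beta_f : f(alpha_f) in the tangent case, or infinity (None) *)
Definition beta (f : Mob) : option C :=
  if excluded_middle_informative (tangent f)
  then Some (mob_eval f (alpha f)) else None.

Definition gamma (f : Mob) : R := / Cnorm (mob_deriv f (alpha f)).

Definition fam (fs : list Mob) (i : nat) : Mob := nth i fs mob_id.

Definition distinct_maps (fs : list Mob) : Prop :=
  forall i j, (i < length fs)%nat -> (j < length fs)%nat -> i <> j ->
    exists z, Cnorm z < 1 /\ mob_eval (fam fs i) z <> mob_eval (fam fs j) z.

Definition tedge (fs : list Mob) (i j : nat) : Prop :=
  Some (alpha (fam fs i)) = beta (fam fs j).

Definition has_cycle (fs : list Mob) : Prop :=
  exists (p : nat -> nat) (m : nat),
    (1 <= m)%nat /\ p 0%nat = p m /\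
    (forall i, (i <= m)%nat -> (p i < length fs)%nat) /\
    (forall i, (1 <= i <= m)%nat -> tedge fs (p (i - 1)%nat) (p i)).

Definition adj (fs : list Mob) (i j : nat) : R :=
  if excluded_middle_informative (tedge fs i j) then 1 else 0.

Fixpoint Csum (n : nat) (g : nat -> C) : C :=
  match n with O => C0 | S k => Cadd (Csum k g) (g k) end.

Definition is_eigenvalue (fs : list Mob) (lam : C) : Prop :=
  exists v : nat -> C,
    (exists i, (i < length fs)%nat /\ v i <> C0) /\
    forall i, (i < length fs)%nat ->
      Csum (length fs) (fun j => Cmul (RtoC (adj fs i j)) (v j)) = Cmul lam (v i).

Definition spectral_radius (fs : list Mob) : R :=
  epsilon (inhabits 0) (fun r =>
    (exists lam, is_eigenvalue fs lam /\ Cnorm lam = r) /\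
    (forall lam, is_eigenvalue fs lam -> Cnorm lam <= r)).

Definition in_Omega (n : nat) (x : nat -> nat) : Prop := forall i, (x i < n)%nat.

(* d(x,y) = n^{-k}, k = 1-based index of first difference; 0 if equal *)
Definition dist_spec (n : nat) (x y : nat -> nat) (r : R) : Prop :=
  ((forall i, x i = y i) /\ r = 0) \/
  (exists k, (forall i, (i < k)%nat -> x i = y i) /\ x k <> y k /\
             r = / (INR n ^ (S k))).

Definition dist (n : nat) (x y : nat -> nat) : R :=
  epsilon (inhabits 0) (dist_spec n x y).

Definition diam (n : nat) (U : (nat -> nat) -> Prop) : R :=
  epsilon (inhabits 0) (fun r =>
    (~ (exists x, U x) /\ r = 0) \/
    ((exists x, U x) /\
     is_lub (fun t => exists x y, U x /\ U y /\ t = dist n x y) r)).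

(* diam(U)^s with conventions diam(empty)^s = 0 and 0^0 = 1 *)
Definition diam_pow (n : nat) (U : (nat -> nat) -> Prop) (s : R) : R :=
  if excluded_middle_informative (exists x, U x) then
    (if Req_dec_T (diam n U) 0 then (if Req_dec_T s 0 then 1 else 0)
     else Rpower (diam n U) s)
  else 0.

(* H^s(E) = 0, i.e. H^s_delta(E) = 0 for every delta > 0 *)
Definition hausdorff_null (n : nat) (s : R) (E : (nat -> nat) -> Prop) : Prop :=
  forall delta eps, 0 < delta -> 0 < eps ->
    exists U : nat -> ((nat -> nat) -> Prop),
      (forall i x, U i x -> in_Omega n x) /\
      (forall i, diam n (U i) <= delta) /\
      (forall x, E x -> exists i, U i x) /\
      exists l, infinite_sum (fun i => diam_pow n (U i) s) l /\ l < eps.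

Definition hdim_is (n : nat) (E : (nat -> nat) -> Prop) (v : R) : Prop :=
  (forall s, 0 <= s -> hausdorff_null n s E -> v <= s) /\
  (forall w, (forall s, 0 <= s -> hausdorff_null n s E -> w <= s) -> w <= v).

Fixpoint comp (fs : list Mob) (x : nat -> nat) (m : nat) (w : C) : C :=
  match m with
  | O => w
  | S k => comp fs x k (mob_eval (fam fs (x k)) w)
  end.

Definition limit_disc (fs : list Mob) (x : nat -> nat) : Prop :=
  exists (c : C) (r : R), 0 < r /\
    forall z, (forall m, (1 <= m)%nat -> exists w, Cnorm w <= 1 /\ comp fs x m w = z)
              <-> Cnorm (Csub z c) <= r.

Definition Lambda (fs : list Mob) (x : nat -> nat) : Prop :=
  in_Omega (length fs) x /\ limit_disc fs x.

(* Main.v *)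
(** The hypothesis [gamma f < 1] forces every [f] to be internally tangent, since Schwarz's
    lemma gives [gamma f >= 1] at the origin otherwise. In half-plane coordinates at the
    tangency points [f] is then [w |-> gamma w + b] with [Re b > 0]. Along an infinite path of
    the tangency graph these affine maps preserve a half-plane, because [gamma < 1], so the
    composition sequence is of limit-disc type; at every non-edge the radius of the image disc
    shrinks by a uniform factor, so infinitely many non-edges leave a single point. Hence
    [Lambda] consists of the sequences that eventually follow edges: a countable union of
    copies of subshifts of finite type.

    Perron-Frobenius theory for the adjacency matrix gives the dimension: positive vectors [u]
    with [A u <= t u], [t] slightly above the spectral radius [r], bound the number of paths,
    and a nonnegative eigenvector for [r] defines a Markov measure giving mass [O(r^-k)] to
    cylinders of length [k]. *)

From Stdlib Require Import Reals List ClassicalEpsilon Classical Lra Lia.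
From Stdlib Require Cantor FinFun.
From Coquelicot Require Import Coquelicot.
Require Import Defs.
Open Scope R_scope.

(** * Finite sums and Hausdorff measure on sequence space *)

(** An intersection of nested closed discs is always a closed disc, whose radius is the limit of the
    radii, so deciding the type of a composition sequence only requires following those radii.

    The tangency graph may be reducible, so a nonnegative eigenvector for [r] can vanish at some
    vertices and a positive one need not exist. It therefore serves only the lower bound. The upper
    bound uses solutions of [A u + 1 <= t u], which are automatically positive and exist for every
    [t > r]; the same inequality bounds all complex eigenvalues, which identifies [r] with the
    spectral radius.

    No measure on sequence space is constructed. The Markov measure is a function on finite words,
    additive under adding a letter, and a cover of small total mass is defeated by choosing letter
    by letter a path that leaves every covering cylinder. *)

Lemma functional_choice {A B : Type} (Q : A -> B -> Prop) :
  (forall a, exists b, Q a b) -> exists f, forall a, Q a (f a).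
Proof.
  intros H. exists (fun a => proj1_sig (constructive_indefinite_description _ (H a))).
  intros a. apply proj2_sig.
Qed.

Definition lsum {A : Type} (f : A -> R) (l : list A) : R :=
  fold_right (fun a s => f a + s) 0 l.

Lemma lsum_ext {A : Type} (f g : A -> R) (l : list A) :
  (forall a, In a l -> f a = g a) -> lsum f l = lsum g l.
Proof.
  induction l as [|a l IH]; simpl; intros H; [easy|].
  rewrite IH, (H a); auto.
Qed.

Lemma lsum_le {A : Type} (f g : A -> R) (l : list A) :
  (forall a, In a l -> f a <= g a) -> lsum f l <= lsum g l.
Proof.
  induction l as [|a l IH]; simpl; intros H; [lra|].
  apply Rplus_le_compat; auto.
Qed.

Lemma lsum_zero {A : Type} (l : list A) : lsum (fun _ => 0) l = 0.
Proof. induction l; simpl; lra. Qed.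

Lemma lsum_nonneg {A : Type} (f : A -> R) (l : list A) :
  (forall a, In a l -> 0 <= f a) -> 0 <= lsum f l.
Proof.
  intros H; rewrite <- (lsum_zero l); apply lsum_le, H.
Qed.

Lemma lsum_app {A : Type} (f : A -> R) (l1 l2 : list A) :
  lsum f (l1 ++ l2) = lsum f l1 + lsum f l2.
Proof. induction l1 as [|a l IH]; simpl; [lra|rewrite IH; lra]. Qed.

Lemma lsum_map {A B : Type} (f : B -> R) (g : A -> B) (l : list A) :
  lsum f (map g l) = lsum (fun a => f (g a)) l.
Proof. induction l as [|a l IH]; simpl; [easy|now rewrite IH]. Qed.

Lemma lsum_flat_map {A B : Type} (f : B -> R) (g : A -> list B) (l : list A) :
  lsum f (flat_map g l) = lsum (fun a => lsum f (g a)) l.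
Proof. induction l as [|a l IH]; simpl; [easy|now rewrite lsum_app, IH]. Qed.

Lemma lsum_filter {A : Type} (f : A -> R) (p : A -> bool) (l : list A) :
  lsum f (filter p l) = lsum (fun a => (if p a then 1 else 0) * f a) l.
Proof. induction l as [|a l IH]; simpl; [easy|destruct (p a); simpl; rewrite IH; ring]. Qed.

Lemma lsum_scal {A : Type} (c : R) (f : A -> R) (l : list A) :
  lsum (fun a => c * f a) l = c * lsum f l.
Proof. induction l as [|a l IH]; simpl; [lra|rewrite IH; lra]. Qed.

Lemma lsum_plus {A : Type} (f g : A -> R) (l : list A) :
  lsum (fun a => f a + g a) l = lsum f l + lsum g l.
Proof. induction l as [|a l IH]; simpl; [lra|rewrite IH; lra]. Qed.

Lemma lsum_term_le {A : Type} (f : A -> R) (l : list A) (a : A) :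
  (forall b, In b l -> 0 <= f b) -> In a l -> f a <= lsum f l.
Proof.
  induction l as [|b l IH]; simpl; intros H Ha; [easy|].
  assert (H0 : 0 <= lsum f l) by (apply lsum_nonneg; auto).
  assert (H1 := H b (or_introl eq_refl)).
  destruct Ha as [->|Ha]; [lra|].
  specialize (IH (fun c Hc => H c (or_intror Hc)) Ha); lra.
Qed.

Lemma lsum_incl {A : Type} (f : A -> R) (l l' : list A) :
  NoDup l -> incl l l' -> (forall b, 0 <= f b) -> lsum f l <= lsum f l'.
Proof.
  intros Hl; revert l'; induction Hl as [|a l Ha Hl IH]; intros l' Hi Hp.
  - apply lsum_nonneg; auto.
  - destruct (in_split a l' (Hi a (or_introl eq_refl))) as (l1 & l2 & ->).
    assert (H : lsum f l <= lsum f (l1 ++ l2)).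
    { apply IH; auto. intros b Hb.
      assert (H := Hi b (or_intror Hb)). rewrite in_app_iff in *; simpl in H.
      destruct H as [H|[->|H]]; tauto. }
    rewrite lsum_app in *; simpl; lra.
Qed.

Lemma lsum_seq (f : nat -> R) (N : nat) : sum_f_R0 f N = lsum f (seq 0 (S N)).
Proof.
  induction N as [|N IH]; [simpl; lra|].
  rewrite seq_S, lsum_app, tech5, IH; simpl; lra.
Qed.

(** Serves to read a finite cover as an infinite sequence padded with the empty set [d], whose
    weight is 0. *)
Lemma lsum_seq_nth_le {A : Type} (f : A -> R) (d : A) (l : list A) (m : nat) :
  (forall a, 0 <= f a) -> f d = 0 ->
  lsum (fun b => f (nth b l d)) (seq 0 m) <= lsum f l.
Proof.
  intros Hp Hd; revert m; induction l as [|a l IH]; intros m.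
  - rewrite (lsum_ext _ (fun _ => 0)), lsum_zero; [apply Rle_refl|].
    intros [|b] _; exact Hd.
  - destruct m as [|m]; [apply lsum_nonneg; auto|].
    simpl seq; rewrite <- seq_shift; simpl; rewrite lsum_map.
    specialize (IH m); lra.
Qed.

Lemma infinite_sum_bounded (f : nat -> R) (B : R) :
  (forall i, 0 <= f i) -> (forall N, sum_f_R0 f N <= B) ->
  exists l, infinite_sum f l /\ l <= B.
Proof.
  intros Hp HB.
  destruct (growing_cv (sum_f_R0 f)) as [l Hl].
  - intros N; rewrite tech5; specialize (Hp (S N)); lra.
  - exists B; intros y (N & ->); apply HB.
  - exists l; split; [exact Hl|].
    apply is_lim_seq_Reals in Hl.
    exact (is_lim_seq_le _ _ l B HB Hl (is_lim_seq_const B)).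
Qed.

Lemma nat_least (P : nat -> Prop) :
  (exists k, P k) -> exists k, P k /\ forall i, (i < k)%nat -> ~ P i.
Proof.
  intros (k & Hk); apply NNPP; intros Hn.
  assert (H : forall m, forall i, (i < m)%nat -> ~ P i).
  { induction m as [|m IH]; intros i Hi; [lia|].
    intros HP; apply Hn; exists i; split; [exact HP|].
    intros j Hj; apply IH; lia. }
  exact (H (S k) k (Nat.lt_succ_diag_r k) Hk).
Qed.

(** * Distance, diameter and countable unions of null sets *)

Lemma dist_specP (n : nat) (x y : nat -> nat) : dist_spec n x y (dist n x y).
Proof.
  unfold dist; apply epsilon_spec.
  destruct (classic (forall i, x i = y i)) as [H|H].
  - exists 0; left; auto.
  - destruct (nat_least (fun k => x k <> y k)) as (k & Hk & Hl).
    { apply not_all_ex_not in H; exact H. }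
    exists (/ INR n ^ S k); right; exists k; repeat split; auto.
    intros i Hi; apply NNPP; exact (Hl i Hi).
Qed.

Lemma dist_agree_le (n k : nat) (x y : nat -> nat) :
  (1 <= n)%nat -> (forall i, (i < k)%nat -> x i = y i) -> dist n x y <= / INR n ^ k.
Proof.
  intros Hn H. assert (Hb : 1 <= INR n) by (change 1 with (INR 1); apply le_INR; lia).
  destruct (dist_specP n x y) as [[_ ->]|(j & Hj & Hne & ->)].
  - apply Rlt_le, Rinv_0_lt_compat, pow_lt; lra.
  - apply Rinv_le_contravar; [apply pow_lt; lra|].
    apply Rle_pow; [exact Hb|].
    destruct (Nat.lt_ge_cases j k); [now elim Hne; apply H|lia].
Qed.

Lemma dist_nonneg (n : nat) (x y : nat -> nat) : (1 <= n)%nat -> 0 <= dist n x y.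
Proof.
  intros Hn. assert (Hb : 1 <= INR n) by (change 1 with (INR 1); apply le_INR; lia).
  destruct (dist_specP n x y) as [[_ ->]|(j & Hj & Hne & ->)]; [lra|].
  apply Rlt_le, Rinv_0_lt_compat, pow_lt; lra.
Qed.

Lemma dist_lt_agree (n k : nat) (x y : nat -> nat) :
  (1 <= n)%nat -> dist n x y < / INR n ^ k -> forall i, (i < k)%nat -> x i = y i.
Proof.
  intros Hn H i Hi. assert (Hb : 1 <= INR n) by (change 1 with (INR 1); apply le_INR; lia).
  destruct (dist_specP n x y) as [[He _]|(j & Hj & Hne & E)]; [apply He|].
  apply Hj. destruct (Nat.lt_ge_cases i j) as [|Hji]; [easy|exfalso].
  rewrite E in H. apply (Rlt_irrefl (/ INR n ^ S j)).
  eapply Rlt_le_trans; [exact H|].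
  apply Rinv_le_contravar; [apply pow_lt; lra|].
  apply Rle_pow; [exact Hb|lia].
Qed.

Lemma diam_empty (n : nat) (U : (nat -> nat) -> Prop) :
  ~ (exists x, U x) -> diam n U = 0.
Proof.
  intros H; unfold diam.
  match goal with |- epsilon ?i ?P = _ => assert (HP : P (epsilon i P)) end.
  { apply epsilon_spec; exists 0; auto. }
  cbv beta in HP. destruct HP as [[_ E]|[E _]]; [exact E|contradiction].
Qed.

Lemma diam_lub (n : nat) (U : (nat -> nat) -> Prop) (x0 : nat -> nat) :
  (1 <= n)%nat -> U x0 ->
  is_lub (fun t => exists x y, U x /\ U y /\ t = dist n x y) (diam n U).
Proof.
  intros Hn H0; unfold diam.
  match goal with |- is_lub _ (epsilon ?i ?P) => assert (HP : P (epsilon i P)) end.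
  { apply epsilon_spec.
    destruct (completeness (fun t => exists x y, U x /\ U y /\ t = dist n x y)) as [r Hr].
    - exists 1; intros t (x & y & _ & _ & ->).
      rewrite <- Rinv_1; apply (dist_agree_le n 0); [exact Hn|intros; lia].
    - exists (dist n x0 x0), x0, x0; auto.
    - exists r; right; eauto. }
  cbv beta in HP. destruct HP as [[E _]|[_ E]]; [|exact E].
  elim E; eauto.
Qed.

Lemma diam_le (n : nat) (U : (nat -> nat) -> Prop) (b : R) :
  (1 <= n)%nat -> 0 <= b -> (forall x y, U x -> U y -> dist n x y <= b) ->
  diam n U <= b.
Proof.
  intros Hn Hb H. destruct (classic (exists x, U x)) as [(x & Hx)|He].
  - apply (diam_lub n U x Hn Hx). intros t (y & z & Hy & Hz & ->); auto.
  - now rewrite diam_empty.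
Qed.

Lemma dist_le_diam (n : nat) (U : (nat -> nat) -> Prop) (x y : nat -> nat) :
  (1 <= n)%nat -> U x -> U y -> dist n x y <= diam n U.
Proof.
  intros Hn Hx Hy. apply (diam_lub n U x Hn Hx). eauto.
Qed.

Lemma diam_nonneg (n : nat) (U : (nat -> nat) -> Prop) : (1 <= n)%nat -> 0 <= diam n U.
Proof.
  intros Hn. destruct (classic (exists x, U x)) as [(x & Hx)|He].
  - eapply Rle_trans; [apply (dist_nonneg n x x Hn)|apply dist_le_diam; auto].
  - rewrite diam_empty; auto; lra.
Qed.

Lemma diam_pow_empty (n : nat) (U : (nat -> nat) -> Prop) (s : R) :
  ~ (exists x, U x) -> diam_pow n U s = 0.
Proof.
  intros H; unfold diam_pow. now destruct excluded_middle_informative.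
Qed.

Lemma diam_pow_nonneg (n : nat) (U : (nat -> nat) -> Prop) (s : R) :
  0 <= diam_pow n U s.
Proof.
  unfold diam_pow. destruct excluded_middle_informative; [|lra].
  destruct Req_dec_T; [destruct Req_dec_T; lra|].
  unfold Rpower; apply Rlt_le, exp_pos.
Qed.

Lemma diam_pow_le (n : nat) (U : (nat -> nat) -> Prop) (s b : R) :
  (1 <= n)%nat -> 0 < s -> 0 < b -> diam n U <= b -> diam_pow n U s <= Rpower b s.
Proof.
  intros Hn Hs Hb H. unfold diam_pow.
  assert (Hp : 0 < Rpower b s) by apply exp_pos.
  destruct excluded_middle_informative; [|lra].
  destruct Req_dec_T; [destruct Req_dec_T; lra|].
  apply Rle_Rpower_l; [lra|].
  assert (H0 := diam_nonneg n U Hn). lra.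
Qed.

Lemma diam_pow_pos_eq (n : nat) (U : (nat -> nat) -> Prop) (s : R) (x : nat -> nat) :
  U x -> 0 < diam n U -> diam_pow n U s = Rpower (diam n U) s.
Proof.
  intros Hx H. unfold diam_pow.
  destruct excluded_middle_informative as [_|E]; [|elim E; eauto].
  destruct Req_dec_T; [lra|easy].
Qed.

(** Reduces arbitrary covers to covers by cylinders, at the cost of a factor [INR n] in the
    diameter. The length [k] is the least one with [/ INR n ^ S k <= diam n U]; if it is positive,
    minimality puts all distances in [U] below [/ INR n ^ k]. *)
Lemma subset_cylinder (n : nat) (U : (nat -> nat) -> Prop) (x : nat -> nat) :
  (2 <= n)%nat -> U x -> 0 < diam n U ->
  exists k, (forall y, U y -> forall i, (i < k)%nat -> y i = x i) /\
            / INR n ^ k <= INR n * diam n U.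
Proof.
  intros Hn Hx Hd. assert (Hb : 2 <= INR n) by (change 2 with (INR 2); apply le_INR; lia).
  destruct (nat_least (fun k => / INR n ^ S k <= diam n U)) as (k & Hk & Hl).
  { destruct (pow_lt_1_zero (/ INR n)) with (y := diam n U) as [N HN]; auto.
    { rewrite Rabs_pos_eq; [|apply Rlt_le, Rinv_0_lt_compat; lra].
      rewrite <- Rinv_1; apply Rinv_lt_contravar; lra. }
    exists N. specialize (HN (S N) ltac:(lia)).
    rewrite pow_inv in HN. apply Rle_trans with (2 := Rlt_le _ _ HN), Rle_abs. }
  exists k; split.
  - intros y Hy i Hi. apply (dist_lt_agree n k); [lia| |exact Hi].
    destruct k as [|k]; [lia|].
    eapply Rle_lt_trans; [apply (dist_le_diam n U); auto; lia|].
    apply Rnot_le_lt, Hl; lia.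
  - replace (/ INR n ^ k) with (INR n * / INR n ^ S k).
    + apply Rmult_le_compat_l; lra.
    + simpl; field; split; [apply pow_nonzero|]; lra.
Qed.

Lemma diam_zero_eq (n : nat) (U : (nat -> nat) -> Prop) (x y : nat -> nat) :
  (1 <= n)%nat -> diam n U = 0 -> U x -> U y -> forall i, y i = x i.
Proof.
  intros Hn Hd Hx Hy i. assert (Hb : 1 <= INR n) by (change 1 with (INR 1); apply le_INR; lia).
  apply (dist_lt_agree n (S i)); [easy| |lia].
  eapply Rle_lt_trans; [apply (dist_le_diam n U); auto|].
  rewrite Hd; apply Rinv_0_lt_compat, pow_lt; lra.
Qed.

(** Nullity through finite covers, which is what cylinders of one fixed length provide; infinite
    sequences of sets appear only when a countable union is formed. *)
Definition finite_covers (n : nat) (s : R) (E : (nat -> nat) -> Prop) : Prop :=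
  forall delta eps, 0 < delta -> 0 < eps ->
    exists l : list ((nat -> nat) -> Prop),
      (forall U, In U l -> (forall x, U x -> in_Omega n x) /\ diam n U <= delta) /\
      (forall x, E x -> exists U, In U l /\ U x) /\
      lsum (fun U => diam_pow n U s) l <= eps.

Lemma lsum_geom_half (c : R) (m : nat) :
  lsum (fun a => c * (/ 2) ^ S a) (seq 0 m) = c * (1 - (/ 2) ^ m).
Proof.
  induction m as [|m IH]; [simpl; lra|].
  rewrite seq_S, lsum_app, IH; simpl; lra.
Qed.

Lemma cantor_box (a b N : nat) : (Cantor.to_nat (a, b) <= N)%nat -> (a <= N /\ b <= N)%nat.
Proof.
  intros H. assert (H1 := Cantor.to_nat_non_decreasing a b). lia.
Qed.

(** The [b]-th set of the cover of [F L] gets the Cantor index of [(L, b)], with the empty set as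
    padding. The cover of [F L] costs at most [eps / 2 * (/ 2) ^ S L]. Since indices up to [N]
    decode into the square of side [N], each partial sum is bounded row by row. *)
Lemma hausdorff_null_countable_union (n : nat) (s : R)
  (E : (nat -> nat) -> Prop) (F : nat -> (nat -> nat) -> Prop) :
  (forall L, finite_covers n s (F L)) -> (forall x, E x -> exists L, F L x) ->
  hausdorff_null n s E.
Proof.
  intros HF HE delta eps Hd He.
  assert (Hl : forall L, exists l : list ((nat -> nat) -> Prop),
      (forall U, In U l -> (forall x, U x -> in_Omega n x) /\ diam n U <= delta) /\
      (forall x, F L x -> exists U, In U l /\ U x) /\
      lsum (fun U => diam_pow n U s) l <= eps / 2 * (/ 2) ^ S L).
  { intros L; apply HF; [exact Hd|].
    apply Rmult_lt_0_compat; [lra|apply pow_lt; lra]. }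
  apply functional_choice in Hl; destruct Hl as (l & Pl).
  set (emp := fun _ : nat -> nat => False).
  assert (Hemp : ~ exists x, emp x) by (intros (x & []) ).
  exists (fun i => nth (snd (Cantor.of_nat i)) (l (fst (Cantor.of_nat i))) emp).
  assert (Hnth : forall a b, In (nth b (l a) emp) (l a) \/ nth b (l a) emp = emp).
  { intros a b. destruct (nth_in_or_default b (l a) emp); auto. }
  split; [|split; [|split]].
  - intros i x Hx. set (a := fst _) in Hx; set (b := snd _) in Hx.
    destruct (Hnth a b) as [H|H]; [exact (proj1 (proj1 (Pl a) _ H) x Hx)|].
    rewrite H in Hx; destruct Hx.
  - intros i. set (a := fst _); set (b := snd _).
    destruct (Hnth a b) as [H|H]; [exact (proj2 (proj1 (Pl a) _ H))|].
    rewrite H, diam_empty; [lra|exact Hemp].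
  - intros x Hx. destruct (HE x Hx) as (L & HL).
    destruct (proj1 (proj2 (Pl L)) x HL) as (U & HU & Ux).
    destruct (In_nth _ _ emp HU) as (b & _ & Hb).
    exists (Cantor.to_nat (L, b)). rewrite Cantor.cancel_of_to; simpl. now rewrite Hb.
  - destruct (infinite_sum_bounded
      (fun i => diam_pow n (nth (snd (Cantor.of_nat i)) (l (fst (Cantor.of_nat i))) emp) s)
      (eps / 2)) as (t & Ht & Hle).
    + intros; apply diam_pow_nonneg.
    + intros N; rewrite lsum_seq.
      pose (g := fun ab : nat * nat => diam_pow n (nth (snd ab) (l (fst ab)) emp) s).
      rewrite (lsum_ext _ (fun i => g (Cantor.of_nat i))) by easy.
      rewrite <- (lsum_map g).
      apply Rle_trans with
        (lsum g (flat_map (fun a => map (pair a) (seq 0 (S N))) (seq 0 (S N)))).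
      { apply lsum_incl.
        - apply FinFun.Injective_map_NoDup; [|apply seq_NoDup].
          intros i j Hij. rewrite <- (Cantor.cancel_to_of i), Hij. apply Cantor.cancel_to_of.
        - intros [a b] Hab. apply in_map_iff in Hab. destruct Hab as (i & Hi & Hin).
          apply in_seq in Hin.
          assert (Hb : (a <= N /\ b <= N)%nat).
          { apply cantor_box. rewrite <- Hi, Cantor.cancel_to_of. lia. }
          apply in_flat_map. exists a; split; [apply in_seq; lia|].
          apply in_map, in_seq; lia.
        - intros; apply diam_pow_nonneg. }
      rewrite lsum_flat_map.
      apply Rle_trans with (lsum (fun a => eps / 2 * (/ 2) ^ S a) (seq 0 (S N))).
      { apply lsum_le; intros a _. rewrite lsum_map; unfold g; simpl fst; simpl snd.
        eapply Rle_trans; [|apply (Pl a)].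
        apply (lsum_seq_nth_le (fun U => diam_pow n U s)).
        - intros; apply diam_pow_nonneg.
        - now apply diam_pow_empty. }
      rewrite lsum_geom_half.
      assert (0 < (/ 2) ^ S N) by (apply pow_lt; lra). nra.
    + exists t; split; [exact Ht|lra].
Qed.

(** * Perron-Frobenius *)

Lemma exists_inf (E : R -> Prop) :
  (exists x, E x) -> (forall x, E x -> 0 <= x) ->
  exists m, 0 <= m /\ (forall x, E x -> m <= x) /\
            (forall b, (forall x, E x -> b <= x) -> b <= m).
Proof.
  intros (x0 & H0) Hp.
  destruct (completeness (fun y => E (- y))) as [m [Hub Hl]].
  - exists 0; intros y Hy. specialize (Hp _ Hy); lra.
  - exists (- x0); now rewrite Ropp_involutive.
  - exists (- m); repeat split.
    + assert (m <= 0); [|lra]. apply Hl; intros y Hy. specialize (Hp _ Hy); lra.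
    + intros x Hx. assert (- x <= m); [|lra]. apply Hub. now rewrite Ropp_involutive.
    + intros b Hb. assert (m <= - b); [|lra]. apply Hl; intros y Hy.
      specialize (Hb _ Hy); lra.
Qed.

Lemma exists_argmax (f : nat -> R) (n : nat) :
  (0 < n)%nat -> exists i, (i < n)%nat /\ forall j, (j < n)%nat -> f j <= f i.
Proof.
  induction n as [|n IH]; intros H; [lia|].
  destruct n as [|n].
  - exists 0%nat; split; [lia|]. intros j Hj; replace j with 0%nat by lia; lra.
  - destruct IH as (i & Hi & Hm); [lia|].
    destruct (Rle_dec (f i) (f (S n))) as [Hc|Hc].
    + exists (S n); split; [lia|]. intros j Hj.
      destruct (Nat.eq_dec j (S n)) as [->|]; [lra|].
      apply Rle_trans with (2 := Hc), Hm; lia.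
    + exists i; split; [lia|]. intros j Hj.
      destruct (Nat.eq_dec j (S n)) as [->|]; [lra|]. apply Hm; lia.
Qed.

Lemma strictly_increasing_lt (phi : nat -> nat) :
  (forall k, (phi k < phi (S k))%nat) -> forall i j, (i < j)%nat -> (phi i < phi j)%nat.
Proof.
  intros H i j Hij; induction Hij as [|j Hij IH]; [apply H|specialize (H j); lia].
Qed.

Lemma bounded_subsequence (u : nat -> R) (a b : R) :
  (forall k, a <= u k <= b) ->
  exists (phi : nat -> nat) (l : R),
    (forall k, (phi k < phi (S k))%nat) /\ is_lim_seq (fun k => u (phi k)) l.
Proof.
  intros Hu.
  destruct (Bolzano_Weierstrass u (fun x => a <= x <= b)) as [l Hl].
  - apply compact_P3.
  - exact Hu.
  - assert (Hc : forall Nk : nat * nat, exists p,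
        (fst Nk <= p)%nat /\ Rabs (u p - l) < / INR (S (snd Nk))).
    { intros [N k]. assert (Hk : 0 < / INR (S k)) by (apply Rinv_0_lt_compat, lt_0_INR; lia).
      destruct (Hl (disc l (mkposreal _ Hk)) N) as (p & Hp & Hd).
      - exists (mkposreal _ Hk). intros x Hx; exact Hx.
      - exists p; split; [exact Hp|exact Hd]. }
    apply functional_choice in Hc; destruct Hc as (g & Hg).
    set (phi := fix phi k := match k with
                             | O => g (O, O) | S j => g (S (phi j), S j) end).
    exists phi, l; split.
    + intros k. simpl. apply (Hg (S (phi k), S k)).
    + apply is_lim_seq_Reals. intros eps He.
      destruct (archimed_cor1 eps He) as (N & HN & HN0).
      exists N; intros k Hk. unfold Rdist.
      apply Rlt_trans with (/ INR (S k)).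
      * destruct k as [|k]; apply (Hg (_, _)).
      * apply Rle_lt_trans with (2 := HN), Rinv_le_contravar; [apply lt_0_INR; lia|].
        apply le_INR; lia.
Qed.

Lemma bounded_vector_subsequence (w : nat -> nat -> R) (b : R) (m : nat) :
  (forall k i, (i < m)%nat -> 0 <= w k i <= b) ->
  exists (phi : nat -> nat) (l : nat -> R),
    (forall k, (phi k < phi (S k))%nat) /\
    forall i, (i < m)%nat -> is_lim_seq (fun k => w (phi k) i) (l i).
Proof.
  induction m as [|m IH]; intros Hw.
  - exists (fun k => k), (fun _ => 0); split; [lia|intros; lia].
  - destruct IH as (phi & l & Hphi & Hl); [intros; apply Hw; lia|].
    destruct (bounded_subsequence (fun k => w (phi k) m) 0 b) as (psi & c & Hpsi & Hc).
    { intros; apply Hw; lia. }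
    exists (fun k => phi (psi k)), (fun i => if Nat.eq_dec i m then c else l i); split.
    + intros k. apply strictly_increasing_lt; auto.
    + intros i Hi. destruct (Nat.eq_dec i m) as [->|Hne]; [exact Hc|].
      apply (is_lim_seq_subseq (fun k => w (phi k) i) (l i) psi).
      * now apply eventually_subseq.
      * apply Hl; lia.
Qed.

Lemma is_lim_seq_lsum (w : nat -> nat -> R) (l : nat -> R) (s : list nat) :
  (forall i, In i s -> is_lim_seq (fun k => w k i) (l i)) ->
  is_lim_seq (fun k => lsum (w k) s) (lsum l s).
Proof.
  induction s as [|i s IH]; intros H.
  - apply is_lim_seq_const.
  - apply (is_lim_seq_plus' (fun k => w k i) (fun k => lsum (w k) s)).
    + apply H; now left.
    + apply IH; intros; apply H; now right.
Qed.

Definition mulvec (n : nat) (A : nat -> nat -> R) (v : nat -> R) (i : nat) : R :=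
  lsum (fun j => A i j * v j) (seq 0 n).

(** A Collatz-Wielandt certificate for the bound [t]: the strict inequality [A u < t u], rescaled so
    that the gap is 1. The gap makes [u] positive without any irreducibility assumption. *)
Definition supersol (n : nat) (A : nat -> nat -> R) (t : R) (u : nat -> R) : Prop :=
  forall i, (i < n)%nat -> 0 <= u i /\ mulvec n A u i + 1 <= t * u i.

Lemma mulvec_le (n : nat) (A : nat -> nat -> R) (u v : nat -> R) (i : nat) :
  (forall j, 0 <= A i j) -> (forall j, (j < n)%nat -> u j <= v j) ->
  mulvec n A u i <= mulvec n A v i.
Proof.
  intros HA H. apply lsum_le; intros j Hj. apply in_seq in Hj.
  apply Rmult_le_compat_l; [apply HA|apply H; lia].
Qed.

Lemma mulvec_nonneg (n : nat) (A : nat -> nat -> R) (v : nat -> R) (i : nat) :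
  (forall j, 0 <= A i j) -> (forall j, (j < n)%nat -> 0 <= v j) -> 0 <= mulvec n A v i.
Proof.
  intros HA H. apply lsum_nonneg; intros j Hj. apply in_seq in Hj.
  apply Rmult_le_pos; [apply HA|apply H; lia].
Qed.

Lemma mulvec_scal (n : nat) (A : nat -> nat -> R) (c : R) (v : nat -> R) (i : nat) :
  mulvec n A (fun j => c * v j) i = c * mulvec n A v i.
Proof.
  unfold mulvec. rewrite <- lsum_scal. apply lsum_ext; intros; ring.
Qed.

Lemma supersol_pos (n : nat) (A : nat -> nat -> R) (t : R) (u : nat -> R) :
  (forall i j, 0 <= A i j) -> (0 < n)%nat -> supersol n A t u -> 0 < t.
Proof.
  intros HA Hn Hu. destruct (Hu 0%nat Hn) as [H0 H1].
  assert (H2 : 0 <= mulvec n A u 0) by (apply mulvec_nonneg; auto; intros; now apply Hu).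
  destruct (Rlt_le_dec 0 t) as [|Ht]; [easy|nra].
Qed.

Lemma supersol_ge (n : nat) (A : nat -> nat -> R) (t : R) (u : nat -> R) (i : nat) :
  (forall i j, 0 <= A i j) -> supersol n A t u -> (i < n)%nat -> 1 <= t * u i.
Proof.
  intros HA Hu Hi. destruct (Hu i Hi) as [H0 H1].
  assert (H2 : 0 <= mulvec n A u i) by (apply mulvec_nonneg; auto; intros; now apply Hu).
  lra.
Qed.

(* The coordinatewise infimum of all supersolutions is again one; were some inequality
   strict there, lowering that coordinate would contradict minimality. *)
Lemma supersol_exact (n : nat) (A : nat -> nat -> R) (t : R) (u : nat -> R) :
  (forall i j, 0 <= A i j) -> (0 < n)%nat -> supersol n A t u ->
  exists v, forall i, (i < n)%nat -> 0 <= v i /\ mulvec n A v i + 1 = t * v i.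
Proof.
  intros HA Hn Hu. assert (Ht := supersol_pos n A t u HA Hn Hu).
  assert (H : forall i, exists m, (i < n)%nat ->
     0 <= m /\ (forall v, supersol n A t v -> m <= v i) /\
     (forall b, (forall v, supersol n A t v -> b <= v i) -> b <= m)).
  { intros i. destruct (Nat.lt_ge_cases i n) as [Hi|]; [|exists 0; intros; lia].
    destruct (exists_inf (fun x => exists v, supersol n A t v /\ x = v i)) as (m & H0 & H1 & H2).
    - eauto.
    - intros x (v & Hv & ->). now apply Hv.
    - exists m; intros _; repeat split; [exact H0| |].
      + intros v Hv; apply H1; eauto.
      + intros b Hb; apply H2. intros x (v & Hv & ->); auto. }
  apply functional_choice in H; destruct H as (v & Hv).
  assert (Sv : supersol n A t v).
  { intros i Hi. destruct (Hv i Hi) as (H0 & H1 & H2). split; [exact H0|].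
    assert (H3 : (mulvec n A v i + 1) / t <= v i).
    { apply H2. intros w Hw. apply Rle_div_l; [exact Ht|].
      rewrite Rmult_comm. apply Rle_trans with (2 := proj2 (Hw i Hi)).
      apply Rplus_le_compat_r, mulvec_le; [auto|]. intros j Hj; now apply (Hv j Hj). }
    apply Rle_div_l in H3; lra. }
  exists v; intros i Hi. destruct (Sv i Hi) as [H0 H1]; split; [exact H0|].
  apply Rle_antisym; [exact H1|].
  (* One step of the iteration [v -> (A v + 1) / t] lowers every coordinate at once and stays a
     supersolution, so minimality forces [v <= v']. *)
  set (v' := fun j => (mulvec n A v j + 1) / t).
  assert (Hle : forall j, (j < n)%nat -> v' j <= v j).
  { intros j Hj. apply Rle_div_l; [exact Ht|]. rewrite Rmult_comm. now apply Sv. }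
  assert (Sv' : supersol n A t v').
  { intros j Hj; split.
    - apply Rmult_le_pos; [|apply Rlt_le, Rinv_0_lt_compat, Ht].
      assert (0 <= mulvec n A v j); [|lra].
      apply mulvec_nonneg; [auto|]. intros; now apply Sv.
    - replace (t * v' j) with (mulvec n A v j + 1) by (unfold v'; field; lra).
      apply Rplus_le_compat_r, mulvec_le; auto. }
  assert (H3 := proj1 (proj2 (Hv i Hi)) v' Sv').
  unfold v' in H3. apply Rle_div_r in H3; lra.
Qed.

(* [r] is the infimum of the [t] admitting a supersolution: as [t] decreases to [r]
   the minimal supersolutions blow up, and their normalisations accumulate at an
   eigenvector. *)
Lemma perron (n : nat) (A : nat -> nat -> R) :
  (forall i j, 0 <= A i j) -> (0 < n)%nat ->
  exists r (v : nat -> R), 0 <= r /\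
    (forall t, r < t -> exists u, supersol n A t u) /\
    (forall t u, supersol n A t u -> r <= t) /\
    (forall i, (i < n)%nat -> 0 <= v i) /\ lsum v (seq 0 n) = 1 /\
    (forall i, (i < n)%nat -> mulvec n A v i = r * v i).
Proof.
  intros HA Hn.
  set (T := fun t => exists u, supersol n A t u).
  assert (Tmono : forall t t', T t -> t <= t' -> T t').
  { intros t t' (u & Hu) Ht. exists u. intros i Hi. destruct (Hu i Hi) as [H0 H1].
    split; [exact H0|]. nra. }
  destruct (exists_inf T) as (r & Hr & Hlow & Hglb).
  (* The constant vector 1 is a supersolution for the largest row sum plus 1, so the infimum is over
     a nonempty set. *)
  - destruct (exists_argmax (fun i => mulvec n A (fun _ => 1) i) n Hn) as (i & Hi & Hm).
    exists (mulvec n A (fun _ => 1) i + 1), (fun _ => 1).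
    intros j Hj; specialize (Hm j Hj); lra.
  - intros t (u & Hu). apply Rlt_le, (supersol_pos n A t u); auto.
  - assert (Habove : forall t, r < t -> T t).
    { intros t Ht. apply NNPP; intros Hnt. apply (Rlt_not_le _ _ Ht), Hglb.
      intros t' Ht'. destruct (Rle_dec t t') as [|Hc]; [easy|].
      elim Hnt. apply (Tmono t'); [exact Ht'|lra]. }
    (* The infimum is not attained: doubling [u] doubles the gap, and the extra unit pays for
       lowering [t] by [/ (2 * max u)]. *)
    assert (Hnot : ~ T r).
    { intros (u & Hu).
      assert (Hr0 := supersol_pos n A r u HA Hn Hu).
      destruct (exists_argmax u n Hn) as (i0 & Hi0 & Hmax).
      assert (Hpos : 0 < u i0).
      { assert (H := supersol_ge n A r u i0 HA Hu Hi0). nra. }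
      assert (H : T (r - / (2 * u i0))).
      { exists (fun i => 2 * u i). intros i Hi. destruct (Hu i Hi) as [H0 H1].
        split; [lra|]. rewrite mulvec_scal.
        assert (H2 : / (2 * u i0) * (2 * u i) <= 1).
        { replace 1 with (/ (2 * u i0) * (2 * u i0)) by (field; lra).
          apply Rmult_le_compat_l; [apply Rlt_le, Rinv_0_lt_compat; lra|].
          specialize (Hmax i Hi); lra. }
        lra. }
      apply Hlow in H. assert (0 < / (2 * u i0)) by (apply Rinv_0_lt_compat; lra). lra. }
    set (tk := fun k : nat => r + / INR (S k)).
    assert (Htk : forall k, 0 < / INR (S k) <= 1).
    { intros k. split; [apply Rinv_0_lt_compat, lt_0_INR; lia|].
      rewrite <- Rinv_1. apply Rinv_le_contravar; [lra|].
      change 1 with (INR 1); apply le_INR; lia. }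
    assert (Hex : forall k, exists v, forall i, (i < n)%nat ->
              0 <= v i /\ mulvec n A v i + 1 = tk k * v i).
    { intros k. destruct (Habove (tk k)) as (u & Hu); [unfold tk; specialize (Htk k); lra|].
      now apply supersol_exact with u. }
    apply functional_choice in Hex; destruct Hex as (u & Hu).
    set (M := fun k => lsum (u k) (seq 0 n)).
    (* Already the coordinate 0 is at least [/ tk k], and [tk k <= r + 1]. This keeps [/ M k]
       bounded. *)
    assert (HM : forall k, / (r + 1) <= M k).
    { intros k.
      assert (Hsup : supersol n A (tk k) (u k)) by (intros i Hi; destruct (Hu k i Hi); lra).
      assert (H := supersol_ge n A _ _ 0%nat HA Hsup Hn).
      assert (H1 : u k 0%nat <= M k).
      { apply lsum_term_le; [|apply in_seq; lia].
        intros b Hb; apply in_seq in Hb; apply Hu; lia. }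
      apply Rmult_le_reg_l with (r + 1); [lra|]. rewrite Rinv_r by lra.
      unfold tk in H. specialize (Htk k). destruct (Hu k 0%nat Hn) as [H0 _]. nra. }
    assert (Hrinv : 0 < / (r + 1)) by (apply Rinv_0_lt_compat; lra).
    assert (HMpos : forall k, 0 < M k) by (intros k; specialize (HM k); lra).
    (* The extra coordinate [n] carries [/ M k], so that one extraction makes it converge together
       with the normalised vector. *)
    set (w := fun k i => if Nat.eq_dec i n then / M k else / M k * u k i).
    destruct (bounded_vector_subsequence w (r + 2) (S n)) as (phi & l & Hphi & Hl).
    { intros k i Hi. unfold w. specialize (HM k); specialize (HMpos k).
      assert (Hinv : 0 < / M k) by now apply Rinv_0_lt_compat.
      destruct (Nat.eq_dec i n) as [->|Hne].
      - split; [lra|]. rewrite <- (Rinv_inv (r + 2)). apply Rinv_le_contravar.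
        + apply Rinv_0_lt_compat; lra.
        + apply Rle_trans with (2 := HM), Rinv_le_contravar; lra.
      - destruct (Hu k i ltac:(lia)) as [H0 _]. split; [apply Rmult_le_pos; lra|].
        apply Rle_trans with 1; [|lra]. rewrite <- (Rinv_l (M k)) by lra.
        apply Rmult_le_compat_l; [lra|]. apply lsum_term_le; [|apply in_seq; lia].
        intros b Hb; apply in_seq in Hb; apply Hu; lia. }
    assert (Hlu : forall i, (i < n)%nat ->
              is_lim_seq (fun k => / M (phi k) * u (phi k) i) (l i)).
    { intros i Hi. apply is_lim_seq_ext with (2 := Hl i ltac:(lia)).
      intros k; unfold w. destruct (Nat.eq_dec i n); [lia|easy]. }
    assert (Hm : is_lim_seq (fun k => / M (phi k)) (l n)).
    { apply is_lim_seq_ext with (2 := Hl n ltac:(lia)).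
      intros k; unfold w. destruct (Nat.eq_dec n n); [easy|lia]. }
    assert (Hl0 : forall i, (i < n)%nat -> 0 <= l i).
    { intros i Hi. apply (is_lim_seq_le (fun _ => 0) _ 0 (l i))
        with (2 := is_lim_seq_const 0) (3 := Hlu i Hi).
      intros k. apply Rmult_le_pos; [apply Rlt_le, Rinv_0_lt_compat, HMpos|now apply Hu]. }
    assert (Htl : is_lim_seq (fun k => tk (phi k)) r).
    { apply is_lim_seq_subseq with (phi := phi) (u := tk); [now apply eventually_subseq|].
      unfold tk. replace r with (r + 0) at 1 by ring.
      apply (is_lim_seq_plus' (fun _ => r) (fun k => / INR (S k)) r 0).
      - apply is_lim_seq_const.
      - apply (is_lim_seq_incr_1 (fun k => / INR k)).
        apply (is_lim_seq_inv INR p_infty is_lim_seq_INR); discriminate. }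
    assert (Heq : forall i, (i < n)%nat -> mulvec n A l i + l n = r * l i).
    { intros i Hi.
      assert (L1 : is_lim_seq
                     (fun k => mulvec n A (fun j => / M (phi k) * u (phi k) j) i + / M (phi k))
                     (mulvec n A l i + l n)).
      { apply is_lim_seq_plus'; [|exact Hm].
        apply (is_lim_seq_lsum (fun k j => A i j * (/ M (phi k) * u (phi k) j))
                 (fun j => A i j * l j)).
        intros j Hj; apply in_seq in Hj.
        apply (is_lim_seq_scal_l _ (A i j) (l j)), Hlu; lia. }
      assert (L2 := is_lim_seq_mult' _ _ _ _ Htl (Hlu i Hi)).
      apply (is_lim_seq_ext _
        (fun k => mulvec n A (fun j => / M (phi k) * u (phi k) j) i + / M (phi k))) in L2.
      - apply is_lim_seq_unique in L1. apply is_lim_seq_unique in L2.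
        rewrite L1 in L2. now injection L2.
      - intros k. rewrite mulvec_scal. destruct (Hu (phi k) i Hi) as [_ E].
        replace (/ M (phi k) * mulvec n A (u (phi k)) i + / M (phi k))
          with (/ M (phi k) * (mulvec n A (u (phi k)) i + 1)) by ring.
        rewrite E; ring. }
    assert (Hsum : lsum l (seq 0 n) = 1).
    { assert (L := is_lim_seq_lsum (fun k i => / M (phi k) * u (phi k) i) l (seq 0 n)).
      assert (L1 : is_lim_seq (fun _ : nat => 1) (lsum l (seq 0 n))).
      { apply is_lim_seq_ext with (2 := L ltac:(intros i Hi; apply in_seq in Hi; apply Hlu; lia)).
        intros k. rewrite lsum_scal. apply Rinv_l. specialize (HMpos (phi k)). fold (M (phi k)). lra. }
      apply is_lim_seq_unique in L1. rewrite Lim_seq_const in L1. now injection L1. }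
    (* A positive limit of [/ M k] would mean that the minimal supersolutions stay bounded along the
       subsequence; rescaling [l] by it then gives a supersolution at [r], against [Hnot]. *)
    assert (Hln : l n = 0).
    { destruct (Rle_lt_or_eq_dec 0 (l n)) as [Hpos|E]; [| |easy].
      - apply (is_lim_seq_le (fun _ => 0) _ 0 (l n)) with (2 := is_lim_seq_const 0) (3 := Hm).
        intros k. apply Rlt_le, Rinv_0_lt_compat, HMpos.
      - elim Hnot. exists (fun i => / l n * l i). intros i Hi.
        assert (Hi' : 0 < / l n) by now apply Rinv_0_lt_compat.
        split; [apply Rmult_le_pos; [lra|auto]|].
        rewrite mulvec_scal. right.
        transitivity (/ l n * (mulvec n A l i + l n)); [field; lra|].
        rewrite (Heq i Hi); ring. }
    exists r, l. split; [exact Hr|]. split; [exact Habove|]. split.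
    { intros t v Hv. apply Hlow. now exists v. }
    split; [exact Hl0|]. split; [exact Hsum|].
    intros i Hi. specialize (Heq i Hi). lra.
Qed.

(** * The spectral radius of the tangency graph *)

Lemma Csum_fst (n : nat) (g : nat -> Defs.C) :
  fst (Csum n g) = lsum (fun j => fst (g j)) (seq 0 n).
Proof.
  induction n as [|n IH]; [easy|]. rewrite seq_S, lsum_app, <- IH; simpl; ring.
Qed.

Lemma Csum_snd (n : nat) (g : nat -> Defs.C) :
  snd (Csum n g) = lsum (fun j => snd (g j)) (seq 0 n).
Proof.
  induction n as [|n IH]; [easy|]. rewrite seq_S, lsum_app, <- IH; simpl; ring.
Qed.

Lemma Cnorm_Csum_le (n : nat) (g : nat -> Defs.C) :
  Cnorm (Csum n g) <= lsum (fun j => Cnorm (g j)) (seq 0 n).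
Proof.
  induction n as [|n IH]; [change (Cmod 0 <= 0); rewrite Cmod_0; lra|].
  rewrite seq_S, lsum_app; simpl.
  eapply Rle_trans; [apply (Cmod_triangle (Csum n g) (g n))|].
  change Cnorm with Cmod in *. lra.
Qed.

Lemma adj_nonneg (fs : list Mob) (i j : nat) : 0 <= adj fs i j.
Proof. unfold adj; destruct excluded_middle_informative; lra. Qed.

Lemma real_eigenvalue (fs : list Mob) (r : R) (v : nat -> R) :
  (forall i, (i < length fs)%nat -> 0 <= v i) -> lsum v (seq 0 (length fs)) = 1 ->
  (forall i, (i < length fs)%nat -> mulvec (length fs) (adj fs) v i = r * v i) ->
  is_eigenvalue fs (Defs.RtoC r).
Proof.
  intros H0 H1 Hv. exists (fun i => Defs.RtoC (v i)); split.
  - apply NNPP; intros Hn. rewrite (lsum_ext _ (fun _ => 0)), lsum_zero in H1; [lra|].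
    intros i Hi; apply in_seq in Hi. apply NNPP; intros Hne. apply Hn.
    exists i; split; [lia|]. intros E; apply Hne. now injection E.
  - intros i Hi. apply injective_projections.
    + rewrite Csum_fst; simpl. rewrite Rmult_0_l, Rminus_0_r, <- (Hv i Hi).
      apply lsum_ext; intros; ring.
    + rewrite Csum_snd; simpl. rewrite (lsum_ext _ (fun _ => 0)), lsum_zero; [ring|].
      intros; ring.
Qed.

(** Maximum principle in the norm weighted by [u]: at an index [i] maximising [|v i| / u i], the
    triangle inequality gives [|lam| |v i| <= m (A u) i <= t |v i|], where [m] is the maximum. *)
Lemma eigenvalue_le_supersol (fs : list Mob) (lam : Defs.C) (t : R) (u : nat -> R) :
  is_eigenvalue fs lam -> supersol (length fs) (adj fs) t u -> Cnorm lam <= t.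
Proof.
  intros (v & (i1 & Hi1 & Hv1) & Hv) Hu. set (n := length fs) in *.
  assert (Hn : (0 < n)%nat) by lia.
  assert (HA := adj_nonneg fs).
  assert (Ht := supersol_pos n _ t u HA Hn Hu).
  assert (Hup : forall i, (i < n)%nat -> 0 < u i).
  { intros i Hi. assert (H := supersol_ge n _ t u i HA Hu Hi). nra. }
  destruct (exists_argmax (fun i => Cmod (v i) / u i) n Hn) as (i & Hi & Hmax).
  set (m := Cmod (v i) / u i) in *.
  assert (Hvm : forall j, (j < n)%nat -> Cmod (v j) <= m * u j).
  { intros j Hj. apply Rle_div_l; [now apply Hup|now apply Hmax]. }
  assert (Hvi : Cmod (v i) = m * u i) by (unfold m; field; specialize (Hup i Hi); lra).
  assert (Hm : 0 < m).
  { assert (H1 : 0 < Cmod (v i1)) by now apply Cmod_gt_0.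
    specialize (Hvm i1 Hi1). specialize (Hup i1 Hi1).
    destruct (Rlt_le_dec 0 m); [easy|nra]. }
  assert (H : Cmod lam * Cmod (v i) <= t * Cmod (v i)).
  { rewrite <- Cmod_mult. change (Cmult lam (v i)) with (Cmul lam (v i)).
    rewrite <- (Hv i Hi).
    eapply Rle_trans; [apply Cnorm_Csum_le|].
    apply Rle_trans with (m * mulvec n (adj fs) u i).
    - unfold mulvec. rewrite <- lsum_scal. apply lsum_le; intros j Hj; apply in_seq in Hj.
      change (Cmod (Cmult (Complex.RtoC (adj fs i j)) (v j)) <= m * (adj fs i j * u j)).
      rewrite Cmod_mult, Cmod_R, Rabs_pos_eq by apply HA.
      specialize (Hvm j ltac:(lia)). specialize (HA i j). nra.
    - rewrite Hvi. destruct (Hu i Hi) as [_ H1]. nra. }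
  apply Rmult_le_reg_r with (Cmod (v i)); [|exact H].
  rewrite Hvi. apply Rmult_lt_0_compat; auto.
Qed.

Lemma spectral_radius_unique (fs : list Mob) (r : R) :
  (exists lam, is_eigenvalue fs lam /\ Cnorm lam = r) ->
  (forall lam, is_eigenvalue fs lam -> Cnorm lam <= r) ->
  spectral_radius fs = r.
Proof.
  intros (l & Hl & El) Hm. unfold spectral_radius.
  match goal with |- epsilon ?i ?P = _ => assert (HP : P (epsilon i P)) end.
  { apply epsilon_spec; exists r; split; [eauto|exact Hm]. }
  cbv beta in HP. destruct HP as [(l' & Hl' & El') Hm'].
  apply Rle_antisym.
  - rewrite <- El' at 1. now apply Hm.
  - rewrite <- El. now apply Hm'.
Qed.

(** The number [r] of [perron] is an eigenvalue, and supersolutions at [t] arbitrarily close to [r]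
    dominate all the others, so it is the value selected by [spectral_radius]. *)
Lemma spectral_radius_perron (fs : list Mob) :
  (0 < length fs)%nat ->
  exists v : nat -> R,
    (forall t, spectral_radius fs < t -> exists u, supersol (length fs) (adj fs) t u) /\
    (forall i, (i < length fs)%nat -> 0 <= v i) /\ lsum v (seq 0 (length fs)) = 1 /\
    (forall i, (i < length fs)%nat ->
       mulvec (length fs) (adj fs) v i = spectral_radius fs * v i).
Proof.
  intros Hn. destruct (perron _ _ (adj_nonneg fs) Hn) as (r & v & Hr & Ht & Hlow & H0 & H1 & Hv).
  rewrite (spectral_radius_unique fs r).
  - exists v; auto.
  - exists (Defs.RtoC r); split; [now apply real_eigenvalue with v|].
    change (Cmod (Complex.RtoC r) = r). rewrite Cmod_R. now apply Rabs_pos_eq.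
  - intros lam Hlam. apply Rnot_lt_le; intros Hlt.
    destruct (Ht ((r + Cnorm lam) / 2)) as (u & Hu); [lra|].
    assert (H := eigenvalue_le_supersol fs lam _ u Hlam Hu). lra.
Qed.

(** If [t <= 1], then [u] drops by at least 1 along every edge, which is impossible around a cycle.
    This yields that the spectral radius is at least 1 when there is a cycle. *)
Lemma supersol_cycle_gt_1 (fs : list Mob) (t : R) (u : nat -> R) :
  has_cycle fs -> supersol (length fs) (adj fs) t u -> 1 < t.
Proof.
  intros (p & m & Hm & Hp & Hlt & Hed) Hu. apply Rnot_le_lt; intros Ht.
  assert (H : forall k, (k <= m)%nat -> u (p k) + INR k <= u (p 0%nat)).
  { induction k as [|k IH]; intros Hk; [simpl; lra|].
    specialize (IH ltac:(lia)). rewrite S_INR.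
    specialize (Hed (S k) ltac:(lia)). replace (S k - 1)%nat with k in Hed by lia.
    destruct (Hu (p k) (Hlt k ltac:(lia))) as [H0 H1].
    assert (H2 : u (p (S k)) <= mulvec (length fs) (adj fs) u (p k)).
    { replace (u (p (S k))) with (adj fs (p k) (p (S k)) * u (p (S k))).
      - apply (lsum_term_le (fun j => adj fs (p k) j * u j)).
        + intros j Hj; apply in_seq in Hj.
          apply Rmult_le_pos; [apply adj_nonneg|apply Hu; lia].
        + apply in_seq. specialize (Hlt (S k) Hk). lia.
      - unfold adj. destruct excluded_middle_informative; [ring|contradiction]. }
    nra. }
  specialize (H m (le_n _)). rewrite <- Hp in H.
  assert (1 <= INR m) by (change 1 with (INR 1); now apply le_INR). lra.
Qed.

(** * Images of the closed disc *)

(** The squared modulus, kept as a polynomial in the coordinates so that identities between moduli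
    are settled by [ring]. *)
Definition nrm (z : Complex.C) : R := fst z ^ 2 + snd z ^ 2.

Lemma nrm_ge0 (z : Complex.C) : 0 <= nrm z.
Proof. unfold nrm; nra. Qed.

Lemma Cmod_sqr (z : Complex.C) : Cmod z ^ 2 = nrm z.
Proof. unfold Cmod. rewrite pow2_sqrt; [easy|apply nrm_ge0]. Qed.

Lemma nrm_mult (z w : Complex.C) : nrm (z * w)%C = nrm z * nrm w.
Proof. unfold nrm; simpl; ring. Qed.

Lemma Cmod_le_nrm (z w : Complex.C) : Cmod z <= Cmod w <-> nrm z <= nrm w.
Proof.
  rewrite <- !Cmod_sqr. assert (H := Cmod_ge_0 z); assert (H' := Cmod_ge_0 w).
  split; intros; nra.
Qed.

Lemma Cmod_lt_nrm (z w : Complex.C) : Cmod z < Cmod w <-> nrm z < nrm w.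
Proof.
  rewrite <- !Cmod_sqr. assert (H := Cmod_ge_0 z); assert (H' := Cmod_ge_0 w).
  split; intros; nra.
Qed.

Lemma Cmod_le_1 (z : Complex.C) : Cmod z <= 1 <-> nrm z <= 1.
Proof. rewrite <- Cmod_1 at 1; rewrite Cmod_le_nrm. unfold nrm; simpl; split; intros; lra. Qed.

Lemma Cmod_lt_1 (z : Complex.C) : Cmod z < 1 <-> nrm z < 1.
Proof. rewrite <- Cmod_1 at 1; rewrite Cmod_lt_nrm. unfold nrm; simpl; split; intros; lra. Qed.

Lemma Cmod_eq_1 (z : Complex.C) : Cmod z = 1 -> nrm z = 1.
Proof. intros H. rewrite <- Cmod_sqr, H; ring. Qed.

Lemma nrm_pos (z : Complex.C) : z <> 0 -> 0 < nrm z.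
Proof. intros H. rewrite <- Cmod_sqr. apply pow_lt. now apply Cmod_gt_0. Qed.

Lemma Cmod_unit_neq0 (z : Complex.C) : Cmod z = 1 -> z <> 0.
Proof. intros H E. rewrite E, Cmod_0 in H; lra. Qed.

Lemma Cminus_neq0 (z w : Complex.C) : z <> w -> (z - w)%C <> 0.
Proof.
  intros H E; apply H. replace z with ((z - w) + w)%C by ring. rewrite E; ring.
Qed.

Lemma conj_mult_self (z : Complex.C) : (z * Cconj z)%C = nrm z.
Proof. apply injective_projections; unfold nrm; simpl; ring. Qed.

Lemma conj_diff (c d : Complex.C) :
  (d * Cconj d - c * Cconj c)%C = Complex.RtoC (nrm d - nrm c).
Proof. rewrite !conj_mult_self. now rewrite <- RtoC_minus. Qed.

Lemma no_pole (c d z : Complex.C) :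
  Cmod c < Cmod d -> Cmod z <= 1 -> (c * z + d)%C <> 0.
Proof.
  intros H Hz E. replace d with (- (c * z))%C in H.
  - rewrite Cmod_opp, Cmod_mult in H. assert (H' := Cmod_ge_0 c). nra.
  - replace d with ((c * z + d) - c * z)%C by ring. rewrite E; ring.
Qed.

(** Otherwise the pole [- d / c], or any point at all when [c = d = 0], lies in the closed disc. *)
Lemma no_pole_inv (c d : Complex.C) :
  (forall z, Cmod z <= 1 -> (c * z + d)%C <> 0) -> Cmod c < Cmod d.
Proof.
  intros H. apply Rnot_le_lt; intros Hle.
  destruct (Ceq_dec c 0) as [->|Hc].
  - apply (H 0%C); [rewrite Cmod_0; lra|].
    rewrite Cmod_0 in Hle. assert (Hd := Cmod_ge_0 d).
    rewrite (Cmod_eq_0 d) by lra. ring.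
  - assert (Hc' : 0 < Cmod c) by now apply Cmod_gt_0.
    apply (H (- d / c)%C).
    + rewrite Cmod_div, Cmod_opp by easy. apply Rle_div_l; lra.
    + now field.
Qed.

(** Centre and radius are read off from the decomposition of [f z] as this centre plus
    [det / (|d|^2 - |c|^2)] times [(conj d * z + conj c) / (c * z + d)]. For [|c| < |d|] the last
    factor is an automorphism of the disc. *)
Definition disc_center (f : Mob) : Complex.C :=
  ((mb f * Cconj (md f) - ma f * Cconj (mc f)) / Complex.RtoC (nrm (md f) - nrm (mc f)))%C.

Definition disc_radius (f : Mob) : R := Cmod (mob_det f) / (nrm (md f) - nrm (mc f)).

Lemma disc_radius_pos (f : Mob) :
  mob_det f <> C0 -> Cmod (mc f) < Cmod (md f) -> 0 < disc_radius f.
Proof.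
  intros H Hcd. apply Cmod_lt_nrm in Hcd.
  apply Rdiv_lt_0_compat; [now apply Cmod_gt_0|lra].
Qed.

Lemma mob_image_disc (f : Mob) (w : Complex.C) :
  mob_det f <> C0 -> Cmod (mc f) < Cmod (md f) ->
  (exists z, Cmod z <= 1 /\ mob_eval f z = w) <->
  Cmod (w - disc_center f)%C <= disc_radius f.
Proof.
  destruct f as [a b c d]. intros Hdet Hcd.
  unfold disc_center, disc_radius; simpl ma; simpl mb; simpl mc; simpl md.
  change (mob_det _) with (a * d - b * c)%C in *.
  change (mob_eval _) with (fun z => (a * z + b) / (c * z + d))%C.
  change Defs.C with Complex.C in *. simpl in Hcd.
  change C0 with (Complex.RtoC 0) in Hdet.
  assert (Hn : nrm c < nrm d) by now apply Cmod_lt_nrm.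
  assert (HD : (d * Cconj d - c * Cconj c)%C <> 0).
  { rewrite conj_diff. intros E. apply RtoC_inj in E. lra. }
  assert (HDR : Cmod (d * Cconj d - c * Cconj c)%C = nrm d - nrm c).
  { rewrite conj_diff, Cmod_R. apply Rabs_pos_eq; lra. }
  rewrite <- conj_diff, <- HDR.
  split.
  - intros (z & Hz & <-). assert (Hp := no_pole c d z Hcd Hz).
    match goal with |- Cmod ?e <= _ =>
      replace e with ((a * d - b * c) / (d * Cconj d - c * Cconj c) *
                      ((Cconj d * z + Cconj c) / (c * z + d)))%C by (field; auto) end.
    rewrite Cmod_mult, !Cmod_div by auto.
    rewrite <- (Rmult_1_r (_ / _)) at 2.
    apply Rmult_le_compat_l.
    { apply Rdiv_le_0_compat; [apply Cmod_ge_0|now apply Cmod_gt_0]. }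
    apply Rle_div_l; [now apply Cmod_gt_0|]. rewrite Rmult_1_l.
    apply Cmod_le_nrm. apply Cmod_le_1 in Hz.
    assert (E : nrm (c * z + d)%C - nrm (Cconj d * z + Cconj c)%C =
                (nrm d - nrm c) * (1 - nrm z)) by (unfold nrm; simpl; ring).
    nra.
  - intros H.
    set (ct := ((b * Cconj d - a * Cconj c) / (d * Cconj d - c * Cconj c))%C) in *.
    set (x := ((w - ct) * (d * Cconj d - c * Cconj c) / (a * d - b * c))%C).
    assert (Hx : Cmod x <= 1).
    { unfold x. rewrite Cmod_div, Cmod_mult by auto.
      apply Rle_div_l; [now apply Cmod_gt_0|]. rewrite Rmult_1_l.
      apply Rle_div_r in H; [exact H|]. now apply Cmod_gt_0. }
    assert (Hq : (Cconj d - c * x)%C <> 0).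
    { replace (Cconj d - c * x)%C with (- c * x + Cconj d)%C by ring.
      apply no_pole; [|exact Hx]. now rewrite Cmod_opp, Cmod_conj. }
    (* The preimage of [x] under the disc automorphism
       [z -> (conj d * z + conj c) / (c * z + d)]. *)
    exists ((d * x - Cconj c) / (Cconj d - c * x))%C; split.
    + rewrite Cmod_div by easy. apply Rle_div_l; [now apply Cmod_gt_0|]. rewrite Rmult_1_l.
      apply Cmod_le_nrm. apply Cmod_le_1 in Hx.
      assert (E : nrm (Cconj d - c * x)%C - nrm (d * x - Cconj c)%C =
                  (nrm d - nrm c) * (1 - nrm x)) by (unfold nrm; simpl; ring).
      nra.
    + replace (c * ((d * x - Cconj c) / (Cconj d - c * x)) + d)%C
        with ((d * Cconj d - c * Cconj c) / (Cconj d - c * x))%C by now field.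
      transitivity (((a * d - b * c) * x + (b * Cconj d - a * Cconj c)) /
                    (d * Cconj d - c * Cconj c))%C; [field; auto|].
      unfold x, ct; field; auto.
Qed.

Lemma disc_extreme_point (c c' : Complex.C) (r : R) :
  0 <= r -> exists p, Cmod (p - c)%C = r /\ Cmod (p - c')%C = Cmod (c - c')%C + r.
Proof.
  intros Hr. destruct (Ceq_dec (c - c')%C 0) as [E|Hne].
  - exists (c + r)%C. rewrite E, Cmod_0. split.
    + replace (c + r - c)%C with (Complex.RtoC r) by ring.
      rewrite Cmod_R. now apply Rabs_pos_eq.
    + replace (c + r - c')%C with ((c - c') + r)%C by ring.
      rewrite E, Cplus_0_l, Cmod_R, Rabs_pos_eq; lra.
  - set (l := Cmod (c - c')%C). assert (Hl : 0 < l) by now apply Cmod_gt_0.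
    exists (c + Complex.RtoC (r / l) * (c - c'))%C. split.
    + replace (c + Complex.RtoC (r / l) * (c - c') - c)%C
        with (Complex.RtoC (r / l) * (c - c'))%C by ring.
      rewrite Cmod_mult, Cmod_R. fold l. rewrite Rabs_pos_eq; [field; lra|].
      apply Rdiv_le_0_compat; lra.
    + replace (c + Complex.RtoC (r / l) * (c - c') - c')%C
        with (Complex.RtoC (1 + r / l) * (c - c'))%C by (rewrite RtoC_plus; ring).
      rewrite Cmod_mult, Cmod_R. fold l. rewrite Rabs_pos_eq; [field; lra|].
      assert (0 <= r / l) by (apply Rdiv_le_0_compat; lra). lra.
Qed.

(** Test the inclusion at the point of the inner disc farthest from [c']. *)
Lemma subdisc_le (c c' : Complex.C) (r r' : R) :
  0 <= r -> (forall z, Cmod (z - c)%C <= r -> Cmod (z - c')%C <= r') ->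
  Cmod (c - c')%C + r <= r'.
Proof.
  intros Hr H. destruct (disc_extreme_point c c' r Hr) as (p & H1 & H2).
  rewrite <- H2. apply H. lra.
Qed.

(** The radii decrease, and [|c p - c m| <= r m - r p] makes the centres Cauchy. That a point of the
    limit disc lies in disc [m] follows by comparing with the centre of disc [p] and letting [p]
    tend to infinity. *)
Lemma nested_discs (c : nat -> Complex.C) (r : nat -> R) :
  (forall m, 0 <= r m) ->
  (forall m p, (m <= p)%nat -> Cmod (c p - c m)%C + r p <= r m) ->
  exists c' r', is_lim_seq r r' /\
    forall z, (forall m, Cmod (z - c m)%C <= r m) <-> Cmod (z - c')%C <= r'.
Proof.
  intros Hr Hc.
  destruct (ex_finite_lim_seq_decr r 0) as [r' Hr']; [|exact Hr|].
  { intros m. specialize (Hc m (S m) (Nat.le_succ_diag_r m)).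
    assert (H := Cmod_ge_0 (c (S m) - c m)%C). lra. }
  (* Stated for any 1-Lipschitz [g], to be applied to the two coordinate functions. *)
  assert (Hcau : forall g : Complex.C -> R,
            (forall z w, Rabs (g z - g w) <= Cmod (z - w)%C) ->
            exists l : R, is_lim_seq (fun m => g (c m)) l).
  { intros g Hg. apply ex_lim_seq_cauchy_corr. intros eps.
    assert (Hrc : ex_lim_seq_cauchy r) by (apply ex_lim_seq_cauchy_corr; now exists r').
    destruct (Hrc eps) as (N & HN). exists N. intros m p Hm Hp.
    apply Rle_lt_trans with (2 := HN m p Hm Hp).
    apply Rle_trans with (1 := Hg _ _).
    destruct (Nat.le_ge_cases m p) as [Hmp|Hmp]; specialize (Hc _ _ Hmp).
    - rewrite <- Cmod_opp, Copp_minus_distr, (Rabs_pos_eq (r m - r p)); [lra|].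
      assert (H := Cmod_ge_0 (c p - c m)%C). lra.
    - rewrite Rabs_minus_sym, Rabs_pos_eq; [lra|].
      assert (H := Cmod_ge_0 (c m - c p)%C). lra. }
  destruct (Hcau fst) as (l1 & Hl1).
  { intros z w. eapply Rle_trans; [|apply Rmax_Cmod].
    eapply Rle_trans; [|apply Rmax_l]. simpl. right; f_equal. }
  destruct (Hcau snd) as (l2 & Hl2).
  { intros z w. eapply Rle_trans; [|apply Rmax_Cmod].
    eapply Rle_trans; [|apply Rmax_r]. simpl. right; f_equal. }
  assert (Hdist : is_lim_seq (fun m => Cmod (c m - (l1, l2))%C) 0).
  { apply is_lim_seq_le_le with (u := fun _ => 0)
      (w := fun m => Rabs (fst (c m) - l1) + Rabs (snd (c m) - l2)).
    - intros m; split; [apply Cmod_ge_0|].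
      replace (c m - (l1, l2))%C
        with (Complex.RtoC (fst (c m) - l1) + Complex.RtoC (snd (c m) - l2) * Ci)%C.
      + eapply Rle_trans; [apply Cmod_triangle|].
        rewrite Cmod_mult, !Cmod_R, Cmod_Ci; lra.
      + apply injective_projections; simpl; ring.
    - apply is_lim_seq_const.
    - replace 0 with (0 + 0) by ring. apply is_lim_seq_plus'.
      + replace 0 with (Rabs (l1 - l1)) by (rewrite Rminus_diag; apply Rabs_R0).
        apply (is_lim_seq_abs _ (l1 - l1)), is_lim_seq_minus'; [exact Hl1|apply is_lim_seq_const].
      + replace 0 with (Rabs (l2 - l2)) by (rewrite Rminus_diag; apply Rabs_R0).
        apply (is_lim_seq_abs _ (l2 - l2)), is_lim_seq_minus'; [exact Hl2|apply is_lim_seq_const]. }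
  exists (l1, l2), r'; split; [exact Hr'|]. intros z; split.
  - intros H.
    assert (L := is_lim_seq_plus' _ _ _ _ Hr' Hdist). rewrite Rplus_0_r in L.
    apply (is_lim_seq_le (fun _ => Cmod (z - (l1, l2))%C) _ (Cmod (z - (l1, l2))%C) r')
      with (2 := is_lim_seq_const _) (3 := L).
    intros m. replace (z - (l1, l2))%C with ((z - c m) + (c m - (l1, l2)))%C by ring.
    eapply Rle_trans; [apply Cmod_triangle|]. specialize (H m); lra.
  - intros H m.
    assert (L : is_lim_seq (fun p => Cmod (c (p + m)%nat - (l1, l2))%C + (r m - r (p + m)%nat) + r')
                 (0 + (r m - r') + r')).
    { apply is_lim_seq_plus'; [|apply is_lim_seq_const].
      apply is_lim_seq_plus'.
      - now apply (is_lim_seq_incr_n (fun p => Cmod (c p - (l1, l2))%C)).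
      - apply is_lim_seq_minus'; [apply is_lim_seq_const|].
        now apply (is_lim_seq_incr_n r). }
    replace (r m) with (0 + (r m - r') + r') by ring.
    apply (is_lim_seq_le (fun _ => Cmod (z - c m)%C) _ (Cmod (z - c m)%C) (0 + (r m - r') + r'))
      with (2 := is_lim_seq_const _) (3 := L).
    intros p. specialize (Hc m (p + m)%nat ltac:(lia)).
    replace (z - c m)%C
      with ((c (p + m)%nat - c m) + - (c (p + m)%nat - (l1, l2)) + (z - (l1, l2)))%C by ring.
    eapply Rle_trans; [apply Cmod_triangle|].
    apply Rplus_le_compat; [|exact H].
    eapply Rle_trans; [apply Cmod_triangle|]. rewrite Cmod_opp. lra.
Qed.

(** * Compositions as single Moebius maps of the closed disc *)

Definition mob_mul (f g : Mob) : Mob :=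
  mkMob (ma f * ma g + mb f * mc g)%C (ma f * mb g + mb f * md g)%C
        (mc f * ma g + md f * mc g)%C (mc f * mb g + md f * md g)%C.

(** Uses the closed disc and allows the image to be all of it, so that [mob_id] and all finite
    products qualify. *)
Definition self_map (f : Mob) : Prop :=
  mob_det f <> C0 /\
  forall z : Complex.C, Cmod z <= 1 ->
    (mc f * z + md f)%C <> 0 /\ Cmod (mob_eval f z) <= 1.

Lemma mob_mul_pole (f g : Mob) (z : Complex.C) :
  (mc g * z + md g)%C <> 0 ->
  (mc (mob_mul f g) * z + md (mob_mul f g))%C =
  ((mc f * mob_eval g z + md f) * (mc g * z + md g))%C.
Proof.
  destruct f as [a b c d], g as [a' b' c' d']. simpl.
  change (mob_eval _) with (fun z => (a' * z + b') / (c' * z + d'))%C.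
  change Defs.C with Complex.C in *. cbv beta. intros H. field. exact H.
Qed.

Lemma mob_eval_mul (f g : Mob) (z : Complex.C) :
  (mc g * z + md g)%C <> 0 -> (mc f * mob_eval g z + md f)%C <> 0 ->
  mob_eval (mob_mul f g) z = mob_eval f (mob_eval g z).
Proof.
  intros H1 H2. assert (H3 := mob_mul_pole f g z H1).
  assert (H4 : ((mc f * mob_eval g z + md f) * (mc g * z + md g))%C <> 0)
    by now apply Cmult_neq_0.
  rewrite <- H3 in H4. clear H3. revert H1 H2 H4.
  destruct f as [a b c d], g as [a' b' c' d']. simpl.
  change (mob_eval (mkMob a' b' c' d')) with (fun z => (a' * z + b') / (c' * z + d'))%C.
  change (mob_eval (mkMob a b c d)) with (fun z => (a * z + b) / (c * z + d))%C.
  change (mob_eval (mob_mul _ _)) with (fun z =>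
    ((a * a' + b * c') * z + (a * b' + b * d')) / ((c * a' + d * c') * z + (c * b' + d * d')))%C.
  change Defs.C with Complex.C in *. cbv beta. intros H1 H2 H4.
  replace (c * ((a' * z + b') / (c' * z + d')) + d)%C
    with (((c * a' + d * c') * z + (c * b' + d * d')) / (c' * z + d'))%C by now field.
  field. auto.
Qed.

Lemma mob_det_mul (f g : Mob) : mob_det (mob_mul f g) = (mob_det f * mob_det g)%C.
Proof. apply injective_projections; simpl; ring. Qed.

Lemma self_map_mul (f g : Mob) : self_map f -> self_map g -> self_map (mob_mul f g).
Proof.
  intros [Hf Ff] [Hg Fg]. split.
  - rewrite mob_det_mul. now apply Cmult_neq_0.
  - intros z Hz. destruct (Fg z Hz) as [P1 Q1]. destruct (Ff _ Q1) as [P2 Q2]. split.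
    + rewrite mob_mul_pole by easy. now apply Cmult_neq_0.
    + rewrite mob_eval_mul by easy. exact Q2.
Qed.

Lemma self_map_mc_md (f : Mob) : self_map f -> Cmod (mc f) < Cmod (md f).
Proof. intros [_ H]. apply no_pole_inv. intros z Hz. now apply H. Qed.

Lemma self_map_image (f : Mob) (w : Complex.C) :
  self_map f -> (exists z, Cmod z <= 1 /\ mob_eval f z = w) <->
  Cmod (w - disc_center f)%C <= disc_radius f.
Proof.
  intros H. apply mob_image_disc; [apply H|now apply self_map_mc_md].
Qed.

Lemma self_map_radius_pos (f : Mob) : self_map f -> 0 < disc_radius f.
Proof. intros H. apply disc_radius_pos; [apply H|now apply self_map_mc_md]. Qed.

Lemma mob_eval_inj (f : Mob) (z w : Complex.C) :
  mob_det f <> C0 -> (mc f * z + md f)%C <> 0 -> (mc f * w + md f)%C <> 0 ->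
  mob_eval f z = mob_eval f w -> z = w.
Proof.
  destruct f as [a b c d]. simpl.
  change (mob_det _) with (a * d - b * c)%C.
  change (mob_eval _) with (fun z => (a * z + b) / (c * z + d))%C.
  change Defs.C with Complex.C in *. change C0 with (Complex.RtoC 0). cbv beta.
  intros H Hz Hw E. apply NNPP; intros Hne.
  assert (E1 : ((a * d - b * c) * (z - w))%C = 0).
  { transitivity (((a * z + b) / (c * z + d) - (a * w + b) / (c * w + d)) *
                  ((c * z + d) * (c * w + d)))%C; [field; auto|].
    rewrite E; ring. }
  revert E1. apply Cmult_neq_0; [exact H|now apply Cminus_neq0].
Qed.

Fixpoint mob_prod (fs : list Mob) (x : nat -> nat) (m : nat) : Mob :=
  match m with
  | O => mob_id
  | S k => mob_mul (mob_prod fs x k) (fam fs (x k))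
  end.

Lemma self_map_id : self_map mob_id.
Proof.
  split.
  - intros E. injection E. lra.
  - intros z Hz.
    change (mob_eval mob_id z) with ((Complex.RtoC 1 * z + 0) / (Complex.RtoC 0 * z + 1))%C.
    change (mc mob_id * z + md mob_id)%C with (Complex.RtoC 0 * z + 1)%C.
    replace (Complex.RtoC 0 * z + 1)%C with (Complex.RtoC 1) by ring. split.
    + apply C1_nz.
    + replace ((Complex.RtoC 1 * z + 0) / 1)%C with z by (field; apply C1_nz). exact Hz.
Qed.

Lemma self_map_prod (fs : list Mob) (x : nat -> nat) (m : nat) :
  (forall i, self_map (fam fs (x i))) -> self_map (mob_prod fs x m).
Proof.
  intros H; induction m as [|m IH]; [apply self_map_id|].
  now apply self_map_mul.
Qed.

Lemma mob_eval_prod (fs : list Mob) (x : nat -> nat) (m : nat) (z : Complex.C) :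
  (forall i, self_map (fam fs (x i))) -> Cmod z <= 1 ->
  mob_eval (mob_prod fs x m) z = comp fs x m z.
Proof.
  intros H; revert z; induction m as [|m IH]; intros z Hz.
  - change (@eq Complex.C ((Complex.RtoC 1 * z + 0) / (Complex.RtoC 0 * z + 1))%C z).
    replace (Complex.RtoC 0 * z + 1)%C with (Complex.RtoC 1) by ring.
    field; apply C1_nz.
  - destruct (proj2 (H m) z Hz) as [P Q].
    change (mob_eval (mob_mul (mob_prod fs x m) (fam fs (x m))) z =
            comp fs x m (mob_eval (fam fs (x m)) z)).
    rewrite mob_eval_mul; [now apply IH|exact P|].
    apply (self_map_prod fs x m H), Q.
Qed.

Lemma comp_image_disc (fs : list Mob) (x : nat -> nat) (m : nat) (w : Complex.C) :
  (forall i, self_map (fam fs (x i))) ->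
  (exists z, Cmod z <= 1 /\ comp fs x m z = w) <->
  Cmod (w - disc_center (mob_prod fs x m))%C <= disc_radius (mob_prod fs x m).
Proof.
  intros H. rewrite <- self_map_image by now apply self_map_prod.
  split; intros (z & Hz & E); exists z; (split; [exact Hz|]).
  - now rewrite mob_eval_prod.
  - now rewrite <- mob_eval_prod.
Qed.

Lemma comp_add (fs : list Mob) (x : nat -> nat) (m p : nat) (w : Defs.C) :
  comp fs x (m + p) w = comp fs x m (comp fs (fun i => x (m + i)%nat) p w).
Proof.
  revert w; induction p as [|p IH]; intros w.
  - now rewrite Nat.add_0_r.
  - rewrite Nat.add_succ_r. simpl. now rewrite IH.
Qed.

Lemma comp_closed_disc (fs : list Mob) (x : nat -> nat) (m : nat) (w : Complex.C) :
  (forall i, self_map (fam fs (x i))) -> Cmod w <= 1 -> Cmod (comp fs x m w) <= 1.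
Proof.
  intros H Hw. rewrite <- mob_eval_prod by easy. apply (self_map_prod fs x m H), Hw.
Qed.

Lemma comp_inj (fs : list Mob) (x : nat -> nat) (m : nat) (z w : Complex.C) :
  (forall i, self_map (fam fs (x i))) -> Cmod z <= 1 -> Cmod w <= 1 ->
  comp fs x m z = comp fs x m w -> z = w.
Proof.
  intros H Hz Hw. rewrite <- !mob_eval_prod by easy.
  destruct (self_map_prod fs x m H) as [D P].
  apply mob_eval_inj; [exact D|now apply P|now apply P].
Qed.

Lemma comp_discs_nested (fs : list Mob) (x : nat -> nat) (m p : nat) :
  (forall i, self_map (fam fs (x i))) -> (m <= p)%nat ->
  Cmod (disc_center (mob_prod fs x p) - disc_center (mob_prod fs x m))%C +
    disc_radius (mob_prod fs x p) <= disc_radius (mob_prod fs x m).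
Proof.
  intros H Hmp. apply subdisc_le.
  - apply Rlt_le, self_map_radius_pos, self_map_prod, H.
  - intros z Hz. apply comp_image_disc in Hz; [|exact H]. destruct Hz as (w & Hw & <-).
    apply comp_image_disc; [exact H|].
    replace p with (m + (p - m))%nat by lia.
    exists (comp fs (fun i => x (m + i)%nat) (p - m) w). split.
    + now apply comp_closed_disc.
    + now rewrite comp_add.
Qed.

(** The intersection is a disc of radius at least half the distance from [p] to [q], hence not a
    point. *)
Lemma limit_disc_of_two_points (fs : list Mob) (x : nat -> nat) (p q : Complex.C) :
  (forall i, self_map (fam fs (x i))) -> p <> q ->
  (forall m, exists w, Cmod w <= 1 /\ comp fs x m w = p) ->
  (forall m, exists w, Cmod w <= 1 /\ comp fs x m w = q) ->
  limit_disc fs x.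
Proof.
  intros H Hpq Hp Hq.
  destruct (nested_discs (fun m => disc_center (mob_prod fs x m))
              (fun m => disc_radius (mob_prod fs x m))) as (c & r & Hr & Hz).
  - intros m. apply Rlt_le, self_map_radius_pos, self_map_prod, H.
  - intros m k Hmk. now apply comp_discs_nested.
  - exists c, r. split.
    + assert (Hd : 0 < Cmod (p - q)%C) by (apply Cmod_gt_0; now apply Cminus_neq0).
      assert (P : Cmod (p - c)%C <= r) by (apply Hz; intros m; now apply comp_image_disc).
      assert (Q : Cmod (q - c)%C <= r) by (apply Hz; intros m; now apply comp_image_disc).
      replace (p - q)%C with ((p - c) + - (q - c))%C in Hd by ring.
      assert (T := Cmod_triangle (p - c)%C (- (q - c))%C). rewrite Cmod_opp in T. lra.
    + intros z. change (Cnorm (Csub z c)) with (Cmod (z - c)%C). rewrite <- Hz. split.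
      (* [limit_disc] only mentions the images for [m >= 1]; the one for [m = 0] is the whole closed
         disc, which contains the image for [m = 1]. *)
      * intros HK [|m].
        -- destruct (HK 1%nat (le_n _)) as (w & Hw & <-).
           apply comp_image_disc; [exact H|].
           exists (comp fs x 1 w); split; [now apply comp_closed_disc|easy].
        -- apply comp_image_disc; [exact H|]. apply HK; lia.
      * intros HK m _. apply comp_image_disc; [exact H|]. apply HK.
Qed.

(* The image of the disc of radius [k] is the image of the unit disc under the map
   precomposed with [z |-> k z]. *)
Lemma disc_radius_scaled (f : Mob) (k r : R) (c : Complex.C) :
  self_map f -> 0 < k < 1 -> 0 <= r ->
  (forall w, Cmod (w - c)%C <= r -> exists z, Cmod z <= k /\ mob_eval f z = w) ->
  r <= k * disc_radius f.
Proof.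
  intros Hf Hk Hr Hw. assert (Hcd := self_map_mc_md f Hf).
  set (g := mkMob (Complex.RtoC k * ma f)%C (mb f) (Complex.RtoC k * mc f)%C (md f)).
  assert (Edet : mob_det g = (Complex.RtoC k * mob_det f)%C)
    by (apply injective_projections; simpl; ring).
  assert (Hk0 : Complex.RtoC k <> 0) by (intros E; apply RtoC_inj in E; lra).
  assert (Hg : mob_det g <> C0).
  { rewrite Edet. apply Cmult_neq_0; [exact Hk0|apply Hf]. }
  assert (Hgcd : Cmod (mc g) < Cmod (md g)).
  { simpl. rewrite Cmod_mult, Cmod_R, Rabs_pos_eq by lra.
    assert (H := Cmod_ge_0 (mc f)). nra. }
  apply Rle_trans with (disc_radius g).
  - assert (H := subdisc_le c (disc_center g) r (disc_radius g) Hr).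
    assert (H0 := Cmod_ge_0 (c - disc_center g)%C).
    enough (Cmod (c - disc_center g)%C + r <= disc_radius g) by lra. apply H.
    intros w Hc. apply mob_image_disc; [exact Hg|exact Hgcd|].
    destruct (Hw w Hc) as (z & Hz & <-).
    exists (z / Complex.RtoC k)%C. split.
    + rewrite Cmod_div, Cmod_R, Rabs_pos_eq by (exact Hk0 || lra). apply Rle_div_l; lra.
    + change (mob_eval g (z / Complex.RtoC k)%C) with
        (((k * ma f) * (z / k) + mb f) / ((k * mc f) * (z / k) + md f))%C.
      replace ((k * ma f) * (z / k))%C with (ma f * z)%C.
      2:{ destruct f as [a b c' d]; simpl. change Defs.C with Complex.C in *. field; auto. }
      replace ((k * mc f) * (z / k))%C with (mc f * z)%C; [easy|].
      destruct f as [a b c' d]; simpl. change Defs.C with Complex.C in *. field; auto.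
  (* The determinant gains the factor [k], while the denominator grows from [|d|^2 - |c|^2] to
     [|d|^2 - k^2 |c|^2]. *)
  - unfold disc_radius. rewrite Edet, Cmod_mult, Cmod_R, Rabs_pos_eq by lra.
    apply Cmod_lt_nrm in Hcd.
    simpl mc; simpl md. rewrite nrm_mult.
    replace (nrm (Complex.RtoC k)) with (k ^ 2) by (unfold nrm; simpl; ring).
    assert (H0 := nrm_ge0 (mc f)).
    unfold Rdiv. rewrite Rmult_assoc.
    apply Rmult_le_compat_l; [lra|]. apply Rmult_le_compat_l; [apply Cmod_ge_0|].
    apply Rinv_le_contravar; [lra|]. assert (k ^ 2 <= 1) by nra. nra.
Qed.

Lemma comp_radius_contract (fs : list Mob) (x : nat -> nat) (m : nat) (k : R) :
  (forall i, self_map (fam fs (x i))) -> 0 < k < 1 ->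
  (forall z, Cmod z <= 1 ->
     Cmod (mob_eval (fam fs (x m)) (mob_eval (fam fs (x (S m))) z)) <= k) ->
  disc_radius (mob_prod fs x (S (S m))) <= k * disc_radius (mob_prod fs x m).
Proof.
  intros H Hk Hz.
  apply disc_radius_scaled with (disc_center (mob_prod fs x (S (S m)))).
  - now apply self_map_prod.
  - exact Hk.
  - apply Rlt_le, self_map_radius_pos, self_map_prod, H.
  - intros w Hw. apply comp_image_disc in Hw; [|exact H]. destruct Hw as (z & Hz1 & <-).
    exists (mob_eval (fam fs (x m)) (mob_eval (fam fs (x (S m))) z)). split; [now apply Hz|].
    rewrite mob_eval_prod; [easy|exact H|].
    apply H, H, Hz1.
Qed.

(** * Tangent maps in half-plane coordinates *)

(** Takes the unit disc to the right half-plane and [al] to infinity. The half-planes of real part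
    at least [Y > 0] correspond to horodiscs at [al]. *)
Definition cayley (al z : Complex.C) : Complex.C := ((al + z) / (al - z))%C.
Definition cayley_inv (al w : Complex.C) : Complex.C := (al * (w - 1) / (w + 1))%C.

Lemma cayley_re (al z : Complex.C) :
  Cmod al = 1 -> z <> al -> fst (cayley al z) * nrm (al - z)%C = 1 - nrm z.
Proof.
  intros Ha Hz. apply Cmod_eq_1 in Ha.
  assert (H : 0 < nrm (al - z)%C) by (apply nrm_pos, Cminus_neq0; auto).
  rewrite <- Ha. unfold cayley. revert H. destruct al as [a1 a2], z as [z1 z2].
  unfold nrm; simpl. intros H. field. lra.
Qed.

Lemma cayley_re_nonneg (al z : Complex.C) :
  Cmod al = 1 -> z <> al -> Cmod z <= 1 <-> 0 <= fst (cayley al z).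
Proof.
  intros Ha Hz. assert (E := cayley_re al z Ha Hz).
  assert (H : 0 < nrm (al - z)%C) by (apply nrm_pos, Cminus_neq0; auto).
  rewrite Cmod_le_1. split; intros; nra.
Qed.

Lemma cayley_re_pos (al z : Complex.C) :
  Cmod al = 1 -> z <> al -> Cmod z < 1 <-> 0 < fst (cayley al z).
Proof.
  intros Ha Hz. assert (E := cayley_re al z Ha Hz).
  assert (H : 0 < nrm (al - z)%C) by (apply nrm_pos, Cminus_neq0; auto).
  rewrite Cmod_lt_1. split; intros; nra.
Qed.

Lemma disc_neq_unit (al z : Complex.C) : Cmod al = 1 -> Cmod z < 1 -> z <> al.
Proof. intros Ha Hz E. rewrite E in Hz. lra. Qed.

Lemma cayley_cayley_inv (al w : Complex.C) :
  Cmod al = 1 -> 0 < fst w ->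
  cayley al (cayley_inv al w) = w /\ Cmod (cayley_inv al w) < 1.
Proof.
  intros Ha Hw. assert (Ha0 := Cmod_unit_neq0 al Ha).
  assert (Hw1 : (w + 1)%C <> 0).
  { intros E. apply (f_equal fst) in E. simpl in E. lra. }
  assert (H2 : Complex.RtoC 2 <> 0) by (intros E; apply RtoC_inj in E; lra).
  assert (Hd : (al - cayley_inv al w)%C = (2 * al / (w + 1))%C).
  { unfold cayley_inv. field. exact Hw1. }
  assert (Hd0 : (al - cayley_inv al w)%C <> 0).
  { rewrite Hd. unfold Complex.Cdiv. repeat apply Cmult_neq_0; auto.
    intros E. apply C1_nz. rewrite <- (Cinv_r (w + 1)%C Hw1), E. ring. }
  assert (E : cayley al (cayley_inv al w) = w).
  { unfold cayley. rewrite Hd. unfold cayley_inv. field. auto. }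
  split; [exact E|]. apply (cayley_re_pos al); [exact Ha| |now rewrite E].
  intros E'. apply Hd0. rewrite E'. ring.
Qed.

Lemma cayley_inj (al z w : Complex.C) :
  Cmod al = 1 -> z <> al -> w <> al -> cayley al z = cayley al w -> z = w.
Proof.
  intros Ha Hz Hw E. assert (Ha0 := Cmod_unit_neq0 al Ha).
  assert (Hz' : (al - z)%C <> 0) by (apply Cminus_neq0; auto).
  assert (Hw' : (al - w)%C <> 0) by (apply Cminus_neq0; auto).
  assert (H2 : Complex.RtoC 2 <> 0) by (intros E'; apply RtoC_inj in E'; lra).
  apply NNPP; intros Hne.
  assert (E1 : (2 * al * (z - w))%C = 0).
  { transitivity ((cayley al z - cayley al w) * ((al - z) * (al - w)))%C.
    - unfold cayley. field. auto.
    - rewrite E. ring. }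
  revert E1. repeat apply Cmult_neq_0; auto. now apply Cminus_neq0.
Qed.

(* In the half-plane coordinates sending [al] and [be] to infinity, [f] is the affine
   map [w |-> g w + b]. *)
Definition normal_form (f : Mob) (al be : Complex.C) (g : R) (b : Complex.C) : Prop :=
  Cmod al = 1 /\ Cmod be = 1 /\ 0 < g /\ 0 < fst b /\
  (mc f * al + md f)%C <> 0 /\ mob_eval f al = be /\
  forall z : Complex.C, Cmod z <= 1 -> z <> al ->
    (mc f * z + md f)%C <> 0 /\ mob_eval f z <> be /\
    cayley be (mob_eval f z) = (g * cayley al z + b)%C.

(** Each failure has an explicit witness: a suitable height on the line of real part 1 if [snd A] is
    nonzero, a point far to the right if [fst A] is negative, a point near the boundary if [fst B]
    is negative. *)
Lemma affine_half_plane (A B : Complex.C) :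
  (forall w : Complex.C, 0 < fst w -> 0 < fst (A * w + B)%C) -> A <> 0 ->
  snd A = 0 /\ 0 < fst A /\ 0 <= fst B.
Proof.
  intros H HA. destruct A as [a1 a2], B as [b1 b2]. simpl in *.
  assert (H' : forall x y, 0 < x -> 0 < a1 * x - a2 * y + b1).
  { intros x y Hx. exact (H (x, y) Hx). }
  assert (E2 : a2 = 0).
  { apply NNPP; intros Hne. specialize (H' 1 ((a1 + b1) / a2) Rlt_0_1).
    replace (a1 * 1 - a2 * ((a1 + b1) / a2) + b1) with 0 in H' by (field; exact Hne). lra. }
  subst a2.
  assert (H1 : forall x, 0 < x -> 0 < a1 * x + b1).
  { intros x Hx. specialize (H' x 0 Hx). lra. }
  assert (Ha1 : a1 <> 0).
  { intros ->. now apply HA. }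
  assert (Hpos : 0 < a1).
  { apply Rnot_le_lt; intros Hle. assert (Hab := Rle_abs b1). assert (Hab' := Rabs_pos b1).
    specialize (H1 ((Rabs b1 + 1) / - a1)).
    assert (Hx : 0 < (Rabs b1 + 1) / - a1) by (apply Rdiv_lt_0_compat; lra).
    specialize (H1 Hx).
    replace (a1 * ((Rabs b1 + 1) / - a1)) with (- (Rabs b1 + 1)) in H1 by (field; lra). lra. }
  repeat split; auto.
  apply Rnot_lt_le; intros Hlt. specialize (H1 (- b1 / (2 * a1))).
  assert (Hx : 0 < - b1 / (2 * a1)) by (apply Rdiv_lt_0_compat; lra).
  specialize (H1 Hx).
  replace (a1 * (- b1 / (2 * a1))) with (- b1 / 2) in H1 by (field; lra). lra.
Qed.

(** The leading coefficient is [be / (al * f'(al))]. The intermediate expression is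
    [2 be / (be - f z) - 1], with [be - f z = det * (al - z) / ((c al + d) (c z + d))]. The first
    identity does not assume [c z + d] nonzero: at a pole the intermediate expression equals -1,
    which later excludes poles on the boundary. *)
Lemma mobius_cayley_affine (a b c d al be : Complex.C) :
  al <> 0 -> (a * d - b * c)%C <> 0 -> (c * al + d)%C <> 0 ->
  be = ((a * al + b) / (c * al + d))%C ->
  forall z, z <> al ->
    (be * (c * al + d) * (c * al + d) / (al * (a * d - b * c)) * cayley al z +
     (be * (c * al + d) * (c * al + d) / (al * (a * d - b * c)) - 1 -
      2 * be * c * (c * al + d) / (a * d - b * c)))%C =
    (2 * be * (c * al + d) * (c * z + d) / ((a * d - b * c) * (al - z)) - 1)%C /\
    ((c * z + d)%C <> 0 ->
      ((a * z + b) / (c * z + d))%C <> be /\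
      cayley be ((a * z + b) / (c * z + d)) =
      (2 * be * (c * al + d) * (c * z + d) / ((a * d - b * c) * (al - z)) - 1)%C).
Proof.
  intros Hal Hdet Hq Hbe z Hz.
  assert (Hz' : (al - z)%C <> 0) by (apply Cminus_neq0; auto).
  split.
  - unfold cayley. field. auto.
  - intros Hp.
    assert (E : (be - (a * z + b) / (c * z + d))%C =
                ((a * d - b * c) * (al - z) / ((c * al + d) * (c * z + d)))%C).
    { rewrite Hbe. field. auto. }
    assert (Hne : (be - (a * z + b) / (c * z + d))%C <> 0).
    { rewrite E. intros E0. apply (Cmult_neq_0 _ _ Hdet Hz').
      transitivity ((a * d - b * c) * (al - z) / ((c * al + d) * (c * z + d)) *
                    ((c * al + d) * (c * z + d)))%C; [field; auto|].
      rewrite E0; ring. }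
    split; [intros E0; apply Hne; rewrite E0; ring|].
    unfold cayley.
    replace (be + (a * z + b) / (c * z + d))%C
      with (2 * be - (be - (a * z + b) / (c * z + d)))%C by ring.
    rewrite E. field. auto.
Qed.

Lemma tangent_normal_form (f : Mob) :
  in_MD f -> tangent f ->
  exists b, normal_form f (alpha f) (mob_eval f (alpha f)) (gamma f) b.
Proof.
  intros (Hdet & Hin & (w0 & Hw0 & Hnot)) Ht.
  assert (Hal : Cnorm (alpha f) = 1 /\ Cnorm (mob_eval f (alpha f)) = 1).
  { unfold alpha. destruct excluded_middle_informative as [_|E]; [|contradiction].
    apply (epsilon_spec (inhabits C0) (fun z => Cnorm z = 1 /\ Cnorm (mob_eval f z) = 1)).
    exact Ht. }
  unfold gamma. generalize dependent (alpha f). intros al [Hal Hbe].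
  clear Ht. destruct f as [a b c d]. unfold normal_form, mob_deriv.
  change (mob_det _) with (a * d - b * c)%C in *.
  change (mob_eval _) with (fun z => (a * z + b) / (c * z + d))%C in *.
  simpl ma in *; simpl mb in *; simpl mc in *; simpl md in *.
  change Cnorm with Cmod in *. change Defs.C with Complex.C in *.
  change C0 with (Complex.RtoC 0) in *.
  change (Cadd (Cmul c al) d) with (c * al + d)%C.
  change (Defs.Cdiv (a * d - b * c)%C (Cmul (c * al + d)%C (c * al + d)%C))
    with ((a * d - b * c) / ((c * al + d) * (c * al + d)))%C.
  cbv beta in *.
  assert (Hin' : forall z : Complex.C, Cmod z < 1 ->
            (c * z + d)%C <> 0 /\ Cmod ((a * z + b) / (c * z + d))%C < 1) by exact Hin.
  clear Hin.
  (* Division by 0 returns 0, so a pole at [al] would give a value of norm 0 instead of 1. *)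
  assert (Hq : (c * al + d)%C <> 0).
  { intros E. rewrite E in Hbe.
    replace ((a * al + b) / 0)%C with (Complex.RtoC 0) in Hbe; [rewrite Cmod_0 in Hbe; lra|].
    apply injective_projections; simpl; unfold Rdiv; ring. }
  assert (Hal0 := Cmod_unit_neq0 al Hal).
  set (be := ((a * al + b) / (c * al + d))%C) in *.
  assert (Hbe0 := Cmod_unit_neq0 be Hbe).
  assert (Haff := mobius_cayley_affine a b c d al be Hal0 Hdet Hq eq_refl).
  set (A := (be * (c * al + d) * (c * al + d) / (al * (a * d - b * c)))%C) in *.
  set (B := (A - 1 - 2 * be * c * (c * al + d) / (a * d - b * c))%C) in *.
  assert (HA0 : A <> 0).
  { unfold A. intros E.
    apply (Cmult_neq_0 _ _ (Cmult_neq_0 _ _ Hbe0 Hq) Hq).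
    transitivity (be * (c * al + d) * (c * al + d) / (al * (a * d - b * c)) *
                  (al * (a * d - b * c)))%C; [field; auto|].
    rewrite E; ring. }
  destruct (affine_half_plane A B) as (HA2 & HA1 & HB1); [|exact HA0|].
  { intros w Hw. destruct (cayley_cayley_inv al w Hal Hw) as [E Hz].
    destruct (Haff (cayley_inv al w) (disc_neq_unit al _ Hal Hz)) as [E1 E2].
    destruct (Hin' _ Hz) as [Hp Hlt]. destruct (E2 Hp) as [Hne E3].
    rewrite E in E1. rewrite E1, <- E3. now apply cayley_re_pos. }
  (* [A] is a positive real number and [be], [al] have norm 1, so it equals its modulus
     [/ |f'(al)|], which is [gamma]. *)
  assert (HAg : A = Complex.RtoC (/ Cmod ((a * d - b * c) / ((c * al + d) * (c * al + d)))%C)).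
  { transitivity (Complex.RtoC (Cmod A)).
    - replace A with (Complex.RtoC (fst A)) at 2 by (apply injective_projections; simpl; auto).
      rewrite Cmod_R, Rabs_pos_eq by lra. apply injective_projections; simpl; auto.
    - f_equal. unfold A. assert (Hqq := Cmult_neq_0 _ _ Hq Hq).
      assert (Had := Cmult_neq_0 _ _ Hal0 Hdet).
      rewrite !Cmod_div, !Cmod_mult, Hbe, Hal by auto.
      field. split; apply Rgt_not_eq; now apply Cmod_gt_0. }
  (* If the real part of [B] were 0, the affine map would be onto the half-plane, and the point [w0]
     omitted by [f] would have a preimage. *)
  assert (HBpos : 0 < fst B).
  { apply Rnot_le_lt; intros HB. assert (EB : fst B = 0) by lra.
    assert (Hw0' := disc_neq_unit be w0 Hbe Hw0).
    set (w := ((cayley be w0 - B) / A)%C).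
    assert (Ew : (A * w + B)%C = cayley be w0) by (unfold w; field; exact HA0).
    assert (Hw : 0 < fst w).
    { assert (H : 0 < fst (cayley be w0)) by now apply cayley_re_pos.
      rewrite <- Ew in H. change (0 < fst A * fst w - snd A * snd w + fst B) in H.
      rewrite HA2, EB in H. nra. }
    destruct (cayley_cayley_inv al w Hal Hw) as [E Hz].
    destruct (Haff (cayley_inv al w) (disc_neq_unit al _ Hal Hz)) as [E1 E2].
    destruct (Hin' _ Hz) as [Hp Hlt]. destruct (E2 Hp) as [Hne E3].
    apply (Hnot _ Hz). apply (cayley_inj be); auto.
    rewrite E3, <- E1, E. exact Ew. }
  exists B. rewrite <- HAg.
  split; [exact Hal|]. split; [exact Hbe|]. split.
  { assert (E := f_equal fst HAg). simpl in E. rewrite <- E. exact HA1. }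
  split; [exact HBpos|]. split; [exact Hq|]. split; [easy|].
  intros z Hz Hne. destruct (Haff z Hne) as [E1 E2].
  assert (Hp : (c * z + d)%C <> 0).
  { intros E. assert (Hre : 0 <= fst (cayley al z)) by now apply cayley_re_nonneg.
    rewrite E in E1.
    replace (2 * be * (c * al + d) * 0 / ((a * d - b * c) * (al - z)) - 1)%C
      with (Complex.RtoC (-1)) in E1.
    - apply (f_equal fst) in E1.
      change (fst A * fst (cayley al z) - snd A * snd (cayley al z) + fst B = -1) in E1.
      rewrite HA2 in E1. nra.
    - replace (-1) with (- (1)) by ring. rewrite RtoC_opp. unfold Complex.Cdiv. ring. }
  destruct (E2 Hp) as [Hb E3]. split; [exact Hp|]. split; [exact Hb|].
  now rewrite E3, <- E1.
Qed.

Lemma deriv_origin_le_1 (a b c d : Complex.C) :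
  (forall z : Complex.C, Cmod z < 1 ->
     (c * z + d)%C <> 0 /\ Cmod ((a * z + b) / (c * z + d))%C < 1) ->
  Cmod (a * d - b * c)%C <= Cmod d * Cmod d.
Proof.
  intros H.
  assert (Hd : d <> 0).
  { destruct (H 0%C) as [H0 _]; [rewrite Cmod_0; lra|]. intros E; apply H0. rewrite E; ring. }
  assert (Hdpos : 0 < Cmod d) by now apply Cmod_gt_0.
  (* Divided difference of [f] at the points [z] and [-z]. *)
  assert (Hsym : forall z, Cmod z < 1 ->
            Cmod (a * d - b * c)%C * Cmod z <= Cmod (d * d - c * c * (z * z))%C).
  { intros z Hz. destruct (H z Hz) as [P1 Q1].
    destruct (H (- z)%C) as [P2 Q2]; [now rewrite Cmod_opp|].
    assert (HP : (d * d - c * c * (z * z))%C = ((c * z + d) * (c * - z + d))%C) by ring.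
    assert (E : (2 * ((a * d - b * c) * z))%C =
      (((a * z + b) / (c * z + d) + - ((a * - z + b) / (c * - z + d))) *
       ((c * z + d) * (c * - z + d)))%C) by (field; auto).
    apply (f_equal Cmod) in E. rewrite !Cmod_mult, Cmod_R, Rabs_pos_eq in E by lra.
    rewrite HP, Cmod_mult.
    assert (T := Cmod_triangle ((a * z + b) / (c * z + d))%C (- ((a * - z + b) / (c * - z + d)))%C).
    rewrite Cmod_opp in T.
    assert (G1 := Cmod_ge_0 (c * z + d)%C). assert (G2 := Cmod_ge_0 (c * - z + d)%C).
    assert (G := Rmult_le_pos _ _ G1 G2). nra. }
  assert (Hcd : Cmod c <= Cmod d).
  { apply Rnot_lt_le; intros Hlt. assert (Hc : c <> 0) by (apply Cmod_gt_0; lra).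
    destruct (H (- d / c)%C) as [P _].
    - rewrite Cmod_div, Cmod_opp by easy. apply Rlt_div_l; lra.
    - apply P. now field. }
  assert (Ht : forall t, 0 < t < 1 -> Cmod (a * d - b * c)%C * t <= Cmod d * Cmod d).
  { intros t Ht. destruct (Ceq_dec c 0) as [->|Hc].
    - specialize (Hsym (Complex.RtoC t)). rewrite Cmod_R, Rabs_pos_eq in Hsym by lra.
      eapply Rle_trans; [apply Hsym; lra|]. rewrite <- Cmod_mult. right; f_equal; ring.
    - assert (Hcpos : 0 < Cmod c) by now apply Cmod_gt_0.
      (* The point [z = s * (d / c)] has modulus [t], and its direction makes [c^2 z^2 = s^2 d^2],
         so that [|d^2 - c^2 z^2| = (1 - s^2) |d|^2] does not exceed [|d|^2]. *)
      set (s := t * Cmod c / Cmod d).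
      assert (Hs : 0 <= s <= 1).
      { unfold s. split; [apply Rdiv_le_0_compat; nra|]. apply Rle_div_l; nra. }
      assert (Hcn : Complex.RtoC s <> 0).
      { intros E. apply RtoC_inj in E.
        assert (0 < s) by (apply Rdiv_lt_0_compat; nra). lra. }
      assert (Hz : Cmod (s * (d / c))%C = t).
      { rewrite Cmod_mult, Cmod_div, Cmod_R, Rabs_pos_eq by (easy || lra).
        unfold s. field. lra. }
      specialize (Hsym (s * (d / c))%C). rewrite Hz in Hsym.
      eapply Rle_trans; [apply Hsym; lra|].
      replace (d * d - c * c * (s * (d / c) * (s * (d / c))))%C
        with (Complex.RtoC (1 - s * s) * (d * d))%C.
      + rewrite !Cmod_mult, Cmod_R, Rabs_pos_eq by nra. nra.
      + rewrite RtoC_minus, RtoC_mult. now field. }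
  apply Rnot_lt_le; intros Hlt. set (D := Cmod (a * d - b * c)%C) in *.
  assert (Hdd : 0 < Cmod d * Cmod d) by nra.
  (* The midpoint of [|d|^2 / D] and 1, a value of [t] at which the bound fails if [|d|^2 < D]. *)
  specialize (Ht ((1 + Cmod d * Cmod d / D) / 2)).
  assert (Hq : Cmod d * Cmod d / D < 1) by (apply Rlt_div_l; lra).
  assert (Hq0 : 0 < Cmod d * Cmod d / D) by (apply Rdiv_lt_0_compat; lra).
  assert (Hle : D * ((1 + Cmod d * Cmod d / D) / 2) <= Cmod d * Cmod d) by (apply Ht; lra).
  replace (D * ((1 + Cmod d * Cmod d / D) / 2)) with ((D + Cmod d * Cmod d) / 2) in Hle
    by (field; lra).
  lra.
Qed.

(* A map without boundary tangency has [alpha f = 0], where Schwarz's lemma gives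
   [gamma f >= 1]. *)
Lemma gamma_lt_1_tangent (f : Mob) : in_MD f -> gamma f < 1 -> tangent f.
Proof.
  intros (Hdet & Hin & _) Hg. apply NNPP; intros Hn.
  revert Hg. unfold gamma, alpha.
  destruct excluded_middle_informative as [E|_]; [contradiction|].
  apply Rle_not_lt. destruct f as [a b c d].
  assert (Hle := deriv_origin_le_1 a b c d Hin).
  unfold mob_deriv. change (mob_det _) with (a * d - b * c)%C in *.
  simpl mc; simpl md.
  change (Cadd (Cmul c C0) d) with (c * 0 + d)%C.
  change (Defs.Cdiv (a * d - b * c)%C (Cmul (c * 0 + d)%C (c * 0 + d)%C))
    with ((a * d - b * c) / ((c * 0 + d) * (c * 0 + d)))%C.
  change Cnorm with Cmod. change Defs.C with Complex.C in *.
  change C0 with (Complex.RtoC 0) in *.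
  destruct (Hin (Complex.RtoC 0)) as [Hd _].
  { change (Cmod 0%C < 1). rewrite Cmod_0; lra. }
  simpl in Hd. change (Cadd (Cmul c (Complex.RtoC 0)) d) with (c * 0 + d)%C in Hd.
  replace (c * 0 + d)%C with d in * by ring. change C0 with (Complex.RtoC 0) in Hd.
  assert (H1 : 0 < Cmod d) by now apply Cmod_gt_0.
  assert (H2 : 0 < Cmod (a * d - b * c)%C) by now apply Cmod_gt_0.
  rewrite Cmod_div, Cmod_mult by (now apply Cmult_neq_0).
  rewrite Rinv_div. apply Rle_div_r; lra.
Qed.

(** * Limit discs and the tangency graph *)

Lemma normal_form_disc (f : Mob) (al be b : Complex.C) (g : R) (z : Complex.C) :
  normal_form f al be g b -> Cmod z <= 1 -> z <> al -> Cmod (mob_eval f z) < 1.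
Proof.
  intros (Hal & Hbe & Hg & Hb & _ & _ & H) Hz Hne.
  destruct (H z Hz Hne) as (_ & Hne' & E).
  apply (cayley_re_pos be); [exact Hbe|exact Hne'|]. rewrite E.
  change (0 < g * fst (cayley al z) - 0 * snd (cayley al z) + fst b).
  apply (cayley_re_nonneg al z Hal Hne) in Hz. nra.
Qed.

Lemma normal_form_self_map (f : Mob) (al be b : Complex.C) (g : R) :
  mob_det f <> C0 -> normal_form f al be g b -> self_map f.
Proof.
  intros Hdet Hf. split; [exact Hdet|]. intros z Hz.
  destruct (Ceq_dec z al) as [->|Hne].
  - destruct Hf as (_ & Hbe & _ & _ & Hp & E & _). split; [exact Hp|].
    rewrite E, Hbe. lra.
  - split.
    + now apply Hf.
    + apply Rlt_le. now apply (normal_form_disc f al be b g).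
Qed.

(** The only boundary value of [g] on the closed disc is [be'], and the only point that [f] leaves
    on the boundary is [al]. *)
Lemma normal_form_comp_interior (f g : Mob) (al be b al' be' b' : Complex.C) (c c' : R) :
  normal_form f al be c b -> normal_form g al' be' c' b' -> al <> be' ->
  forall z, Cmod z <= 1 -> Cmod (mob_eval f (mob_eval g z)) < 1.
Proof.
  intros Hf Hg Hne z Hz. apply (normal_form_disc f al be b c); [exact Hf| |].
  - destruct (Ceq_dec z al') as [->|Hz'].
    + destruct Hg as (_ & Hbe & _ & _ & _ & E & _). rewrite E. lra.
    + apply Rlt_le. now apply (normal_form_disc g al' be' b' c').
  - destruct (Ceq_dec z al') as [->|Hz'].
    + destruct Hg as (_ & _ & _ & _ & _ & E & _). rewrite E. auto.
    + apply disc_neq_unit; [apply Hf|]. now apply (normal_form_disc g al' be' b' c').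
Qed.

(** The image is a closed disc, so its largest modulus [|center| + radius] is attained, hence less
    than 1. *)
Lemma interior_image_bound (f : Mob) :
  self_map f -> (forall z, Cmod z <= 1 -> Cmod (mob_eval f z) < 1) ->
  exists k, k < 1 /\ forall z, Cmod z <= 1 -> Cmod (mob_eval f z) <= k.
Proof.
  intros Hf H.
  assert (Hr := self_map_radius_pos f Hf).
  destruct (disc_extreme_point (disc_center f) 0 (disc_radius f)) as (p & Hp & Ep); [lra|].
  exists (Cmod (disc_center f) + disc_radius f). split.
  - assert (Hp' : exists z, Cmod z <= 1 /\ mob_eval f z = p) by (apply self_map_image; auto; lra).
    destruct Hp' as (z & Hz & <-). specialize (H z Hz).
    unfold Cminus in Ep. rewrite Copp_0, !Cplus_0_r in Ep. lra.
  - intros z Hz.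
    assert (Hd : Cmod (mob_eval f z - disc_center f)%C <= disc_radius f).
    { apply self_map_image; [exact Hf|]. eauto. }
    replace (Cmod (mob_eval f z))
      with (Cmod (disc_center f + (mob_eval f z - disc_center f))%C).
    + eapply Rle_trans; [apply Cmod_triangle|]. lra.
    + f_equal. apply injective_projections; simpl; ring.
Qed.

(* [Y <= (Y - b) / g] as soon as [Y >= b / (1 - g)]: then [f] maps a horodisc at [al]
   onto a superset of the horodisc of the same size at [be]. *)
Lemma normal_form_horodisc (f : Mob) (al be b : Complex.C) (g Y : R) (p : Complex.C) :
  normal_form f al be g b -> fst b <= Y * (1 - g) -> 0 < Y ->
  Cmod p < 1 -> Y <= fst (cayley be p) ->
  exists z, Cmod z < 1 /\ Y <= fst (cayley al z) /\ mob_eval f z = p.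
Proof.
  intros (Hal & Hbe & Hg & Hb & _ & _ & H) HY HY0 Hp Hpy.
  set (w := ((cayley be p - b) / Complex.RtoC g)%C).
  assert (Hg0 : Complex.RtoC g <> 0) by (intros E; apply RtoC_inj in E; lra).
  assert (Ew : (g * w + b)%C = cayley be p) by (unfold w; field; exact Hg0).
  assert (Hw : Y <= fst w).
  { assert (E := f_equal fst Ew).
    change (g * fst w - 0 * snd w + fst b = fst (cayley be p)) in E. nra. }
  destruct (cayley_cayley_inv al w Hal) as [Ez Hz]; [lra|].
  exists (cayley_inv al w). split; [exact Hz|]. split; [now rewrite Ez|].
  destruct (H (cayley_inv al w)) as (_ & Hne & E); [lra|now apply disc_neq_unit|].
  apply (cayley_inj be); [exact Hbe|exact Hne|now apply disc_neq_unit|].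
  rewrite E, Ez. exact Ew.
Qed.

Lemma finite_bound_below_1 (n : nat) (Q : nat -> R -> Prop) :
  (forall i k k', k <= k' -> Q i k -> Q i k') ->
  (forall i, (i < n)%nat -> exists k, k < 1 /\ Q i k) ->
  exists k, 0 < k < 1 /\ forall i, (i < n)%nat -> Q i k.
Proof.
  intros Hm. induction n as [|n IH]; intros H.
  - exists (/ 2). split; [lra|intros; lia].
  - destruct IH as (k & Hk & HQ); [intros; apply H; lia|].
    destruct (H n ltac:(lia)) as (k' & Hk' & HQ').
    exists (Rmax k k'). assert (L := Rmax_l k k'). assert (L' := Rmax_r k k'). split.
    + split; [lra|]. apply Rmax_lub_lt; lra.
    + intros i Hi. destruct (Nat.eq_dec i n) as [->|Hne].
      * now apply (Hm n k').
      * apply (Hm i k); [exact L|apply HQ; lia].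
Qed.

Lemma finite_upper_bound (n : nat) (y : nat -> R) :
  exists Y, 0 < Y /\ forall i, (i < n)%nat -> y i <= Y.
Proof.
  induction n as [|n (Y & HY & H)].
  - exists 1. split; [lra|intros; lia].
  - exists (Rmax Y (y n)). assert (L := Rmax_l Y (y n)). assert (L' := Rmax_r Y (y n)).
    split; [lra|]. intros i Hi. destruct (Nat.eq_dec i n) as [->|Hne]; [exact L'|].
    specialize (H i ltac:(lia)). lra.
Qed.

Definition family_normal_form (fs : list Mob) : Prop :=
  forall i, (i < length fs)%nat ->
    self_map (fam fs i) /\ gamma (fam fs i) < 1 /\
    beta (fam fs i) = Some (mob_eval (fam fs i) (alpha (fam fs i))) /\
    exists b, normal_form (fam fs i) (alpha (fam fs i))
                (mob_eval (fam fs i) (alpha (fam fs i))) (gamma (fam fs i)) b.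

Lemma family_has_normal_form (fs : list Mob) :
  (forall f, In f fs -> in_MD f) -> (forall f, In f fs -> gamma f < 1) ->
  family_normal_form fs.
Proof.
  intros HM HG i Hi. assert (Hin : In (fam fs i) fs) by (now apply nth_In).
  assert (Hf := HM _ Hin). assert (Hg := HG _ Hin).
  assert (Ht := gamma_lt_1_tangent _ Hf Hg).
  destruct (tangent_normal_form _ Hf Ht) as (b & Hb).
  split; [eapply normal_form_self_map; [apply Hf|exact Hb]|].
  split; [exact Hg|]. split; [|eauto].
  unfold beta. now destruct excluded_middle_informative.
Qed.

(** One height [Y] serves all maps of the family. Along an edge [alpha] of one map is [beta] of the
    next, so any point of the horodisc at [BE (x L)] can be pulled back through all later maps,
    always staying in a horodisc of height [Y]. *)
Lemma edges_limit_disc (fs : list Mob) (x : nat -> nat) (L : nat) :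
  family_normal_form fs -> in_Omega (length fs) x ->
  (forall i, (L <= i)%nat -> tedge fs (x i) (x (S i))) -> limit_disc fs x.
Proof.
  intros HF Hx HL.
  assert (Hself : forall i, self_map (fam fs (x i))) by (intros i; now apply HF).
  set (AL := fun i => alpha (fam fs i) : Complex.C).
  set (BE := fun i => mob_eval (fam fs i) (AL i) : Complex.C).
  assert (Hb : forall i, exists b, (i < length fs)%nat ->
            normal_form (fam fs i) (AL i) (BE i) (gamma (fam fs i)) b).
  { intros i. destruct (Nat.lt_ge_cases i (length fs)) as [Hi|Hi].
    - destruct (HF i Hi) as (_ & _ & _ & b & Hb). now exists b.
    - exists (Complex.RtoC 0). intros; lia. }
  apply functional_choice in Hb; destruct Hb as (b & Hb).
  destruct (finite_upper_bound (length fs)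
              (fun i => fst (b i) / (1 - gamma (fam fs i)))) as (Y & HY & HYb).
  assert (Hedge : forall i, (L <= i)%nat -> AL (x i) = BE (x (S i))).
  { intros i Hi. specialize (HL i Hi). unfold tedge in HL.
    destruct (HF (x (S i)) (Hx _)) as (_ & _ & E & _). rewrite E in HL.
    now injection HL. }
  assert (Hchain : forall p, Cmod p < 1 -> Y <= fst (cayley (BE (x L)) p) ->
    forall m, exists z, Cmod z < 1 /\ Y <= fst (cayley (BE (x (L + m)%nat)) z) /\
                        comp fs (fun i => x (L + i)%nat) m z = p).
  { intros p Hp Hpy. induction m as [|m IH].
    - exists p. rewrite Nat.add_0_r. auto.
    - destruct IH as (z & Hz & Hzy & E).
      destruct (normal_form_horodisc _ _ _ _ _ Y z (Hb (x (L + m)%nat) (Hx _)))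
        as (z' & Hz' & Hzy' & E'); auto.
      { specialize (HYb (x (L + m)%nat) (Hx _)). cbv beta in HYb.
        destruct (HF (x (L + m)%nat) (Hx _)) as (_ & Hg & _).
        apply Rle_div_l in HYb; [exact HYb|lra]. }
      exists z'. split; [exact Hz'|]. split.
      + rewrite Hedge in Hzy' by lia. now rewrite Nat.add_succ_r.
      + simpl. rewrite E'. exact E. }
  (* The prefix of length [L] is put back: [comp fs x L p] is a value of the composition of
     [L + m = m + L] maps, hence of the one of the first [m]. *)
  assert (Hfar : forall p, Cmod p < 1 -> Y <= fst (cayley (BE (x L)) p) ->
    forall m, exists w, Cmod w <= 1 /\ comp fs x m w = comp fs x L p).
  { intros p Hp Hpy m. destruct (Hchain p Hp Hpy m) as (z & Hz & _ & E).
    exists (comp fs (fun i => x (m + i)%nat) L z). split.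
    - apply comp_closed_disc; [intros i; apply Hself|lra].
    - rewrite <- comp_add, Nat.add_comm, comp_add. now rewrite E. }
  assert (HBE : Cmod (BE (x L)) = 1) by apply (Hb (x L) (Hx L)).
  (* Two distinct points of the horodisc; injectivity of the prefix keeps them distinct. *)
  destruct (cayley_cayley_inv (BE (x L)) (Complex.RtoC Y) HBE) as [E1 H1]; [exact HY|].
  destruct (cayley_cayley_inv (BE (x L)) (Complex.RtoC (Y + 1)) HBE) as [E2 H2]; [simpl; lra|].
  apply limit_disc_of_two_points with
    (comp fs x L (cayley_inv (BE (x L)) (Complex.RtoC Y)))
    (comp fs x L (cayley_inv (BE (x L)) (Complex.RtoC (Y + 1)))).
  - exact Hself.
  - intros E. apply comp_inj in E; [|exact Hself|lra|lra].
    rewrite E, E2 in E1. apply RtoC_inj in E1. lra.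
  - apply Hfar; [exact H1|]. rewrite E1. simpl; lra.
  - apply Hfar; [exact H2|]. rewrite E2. simpl; lra.
Qed.

Lemma non_edge_uniform_contraction (fs : list Mob) :
  family_normal_form fs ->
  exists k, 0 < k < 1 /\ forall i, (i < length fs)%nat -> forall j, (j < length fs)%nat ->
    ~ tedge fs i j ->
    forall z, Cmod z <= 1 -> Cmod (mob_eval (fam fs i) (mob_eval (fam fs j) z)) <= k.
Proof.
  intros HF.
  apply (finite_bound_below_1 (length fs) (fun i k => forall j, (j < length fs)%nat ->
    ~ tedge fs i j ->
    forall z, Cmod z <= 1 -> Cmod (mob_eval (fam fs i) (mob_eval (fam fs j) z)) <= k)).
  { intros i k k' Hk H j Hj He z Hz. apply Rle_trans with (2 := Hk). now apply (H j). }
  intros i Hi.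
  enough (H : exists k, 0 < k < 1 /\ forall j, (j < length fs)%nat -> ~ tedge fs i j ->
    forall z, Cmod z <= 1 -> Cmod (mob_eval (fam fs i) (mob_eval (fam fs j) z)) <= k).
  { destruct H as (k & Hk & H). exists k. split; [lra|exact H]. }
  apply (finite_bound_below_1 (length fs) (fun j k => ~ tedge fs i j ->
    forall z, Cmod z <= 1 -> Cmod (mob_eval (fam fs i) (mob_eval (fam fs j) z)) <= k)).
  { intros j k k' Hk H He z Hz. apply Rle_trans with (2 := Hk). now apply H. }
  (* For an edge the condition is vacuous, so 0 will do as its bound. *)
  intros j Hj. destruct (classic (tedge fs i j)) as [He|He].
  { exists 0. split; [lra|intros; contradiction]. }
  destruct (HF i Hi) as (Si & _ & _ & b & Hb).
  destruct (HF j Hj) as (Sj & _ & E & b' & Hb').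
  destruct (interior_image_bound (mob_mul (fam fs i) (fam fs j))) as (k & Hk & H).
  - now apply self_map_mul.
  - intros z Hz. destruct (proj2 Sj z Hz) as [P Q]. rewrite mob_eval_mul; [|exact P|now apply Si].
    apply (normal_form_comp_interior _ _ _ _ _ _ _ _ _ _ Hb Hb'); [|exact Hz].
    intros E'. apply He. unfold tedge. rewrite E. now f_equal.
  - exists k. split; [exact Hk|]. intros _ z Hz. specialize (H z Hz).
    destruct (proj2 Sj z Hz) as [P Q].
    rewrite mob_eval_mul in H; [exact H|exact P|now apply Si].
Qed.

Lemma limit_disc_edges (fs : list Mob) (x : nat -> nat) :
  family_normal_form fs -> in_Omega (length fs) x -> limit_disc fs x ->
  exists L, forall i, (L <= i)%nat -> tedge fs (x i) (x (S i)).
Proof.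
  intros HF Hx (c & r & Hr & Hz). apply NNPP; intros Hn.
  assert (Hself : forall i, self_map (fam fs (x i))) by (intros i; now apply HF).
  assert (Hinf : forall L, exists i, (L <= i)%nat /\ ~ tedge fs (x i) (x (S i))).
  { intros L. apply NNPP; intros HnL. apply Hn. exists L. intros i Hi.
    apply NNPP; intros He. apply HnL. eauto. }
  destruct (non_edge_uniform_contraction fs HF) as (k & Hk & Hcon).
  set (rad := fun m => disc_radius (mob_prod fs x m)).
  assert (Hdec : forall m p, (m <= p)%nat -> rad p <= rad m).
  { intros m p Hmp. assert (H := comp_discs_nested fs x m p Hself Hmp).
    assert (H0 := Cmod_ge_0 (disc_center (mob_prod fs x p) - disc_center (mob_prod fs x m))%C).
    unfold rad. lra. }
  assert (Hlow : forall m, r <= rad m).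
  { intros m. apply Rle_trans with (2 := Hdec m (S m) (Nat.le_succ_diag_r m)).
    assert (H := subdisc_le c (disc_center (mob_prod fs x (S m))) r (rad (S m)) (Rlt_le _ _ Hr)).
    enough (Cmod (c - disc_center (mob_prod fs x (S m)))%C + r <= rad (S m)).
    { assert (H1 := Cmod_ge_0 (c - disc_center (mob_prod fs x (S m)))%C). lra. }
    apply H. intros z Hc. apply comp_image_disc; [exact Hself|].
    apply Hz; [exact Hc|lia]. }
  (* A contraction consumes the two letters [x i] and [x (S i)], so the search for the next non-edge
     resumes at [S (S i)]. *)
  assert (Hpow : forall j, exists m, rad m <= k ^ j * rad 0%nat).
  { induction j as [|j (m & IH)]; [exists 0%nat; simpl; lra|].
    destruct (Hinf m) as (i & Hi & He).
    exists (S (S i)).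
    assert (H : rad (S (S i)) <= k * rad i).
    { apply comp_radius_contract; [exact Hself|exact Hk|].
      intros z Hz1. apply Hcon; auto. }
    specialize (Hdec m i Hi). simpl. nra. }
  assert (Hrad0 : 0 < rad 0%nat) by (specialize (Hlow 0%nat); lra).
  destruct (pow_lt_1_zero k) with (y := r / rad 0%nat) as (N & HN).
  { rewrite Rabs_pos_eq; lra. }
  { now apply Rdiv_lt_0_compat. }
  specialize (HN N (le_n _)). destruct (Hpow N) as (m & Hm). specialize (Hlow m).
  rewrite Rabs_pos_eq in HN by (apply pow_le; lra).
  apply Rlt_div_r in HN; lra.
Qed.

(** * Dimension of the path space *)

(* Initial segments are stored most recent letter first. *)
Fixpoint rword (x : nat -> nat) (k : nat) : list nat :=
  match k with O => nil | S j => x j :: rword x j end.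

Lemma rword_length (x : nat -> nat) (k : nat) : length (rword x k) = k.
Proof. induction k; simpl; auto. Qed.

Lemma rword_agree (x y : nat -> nat) (k : nat) :
  rword x k = rword y k -> forall i, (i < k)%nat -> x i = y i.
Proof.
  induction k as [|k IH]; intros E i Hi; [lia|]. simpl in E. injection E as E1 E2.
  destruct (Nat.eq_dec i k) as [->|]; [exact E1|]. apply IH; [exact E2|lia].
Qed.

Lemma rword_ext (x y : nat -> nat) (k : nat) :
  (forall i, (i < k)%nat -> x i = y i) -> rword x k = rword y k.
Proof.
  induction k as [|k IH]; intros H; simpl; [easy|].
  rewrite H by lia. f_equal. apply IH. intros; apply H; lia.
Qed.

Definition edgeb (fs : list Mob) (i j : nat) : bool :=
  if excluded_middle_informative (tedge fs i j) then true else false.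

Definition extend (n : nat) (e : nat -> nat -> bool) (W : list (list nat)) : list (list nat) :=
  flat_map (fun w => map (fun a => a :: w) (filter (e (hd 0%nat w)) (seq 0 n))) W.

Fixpoint extend_iter (n : nat) (e : nat -> nat -> bool) (k : nat) (W : list (list nat)) :=
  match k with O => W | S j => extend n e (extend_iter n e j W) end.

Lemma in_extend (n : nat) (e : nat -> nat -> bool) (W : list (list nat)) (v : list nat) :
  In v (extend n e W) <->
  exists a w, v = a :: w /\ In w W /\ (a < n)%nat /\ e (hd 0%nat w) a = true.
Proof.
  unfold extend. rewrite in_flat_map. split.
  - intros (w & Hw & Hv). apply in_map_iff in Hv. destruct Hv as (a & <- & Ha).
    apply filter_In in Ha. destruct Ha as [Ha He]. apply in_seq in Ha.
    exists a, w. repeat split; auto; lia.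
  - intros (a & w & -> & Hw & Ha & He). exists w; split; [exact Hw|].
    apply (in_map (fun a => a :: w)), filter_In. split; [apply in_seq; lia|exact He].
Qed.

(** The last hypothesis covers the start from the empty word, whose head defaults to 0. *)
Lemma extend_iter_rword (n : nat) (e : nat -> nat -> bool) (W : list (list nat))
  (x : nat -> nat) (l k : nat) :
  in_Omega n x -> In (rword x l) W ->
  (forall i, (l <= S i)%nat -> e (hd 0%nat (rword x (S i))) (x (S i)) = true) ->
  (l = 0%nat -> e 0%nat (x 0%nat) = true) ->
  In (rword x (k + l)) (extend_iter n e k W).
Proof.
  intros Hx HW He H0. induction k as [|k IH]; [exact HW|].
  simpl. apply in_extend. exists (x (k + l)%nat), (rword x (k + l)).
  repeat split; auto.
  destruct (k + l)%nat as [|i] eqn:Ekl; [apply H0; lia|]. apply He; lia.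
Qed.

Lemma extend_iter_length (n : nat) (e : nat -> nat -> bool) (W : list (list nat)) (l k : nat) :
  (forall w, In w W -> length w = l) ->
  forall w, In w (extend_iter n e k W) -> length w = (k + l)%nat.
Proof.
  intros HW. induction k as [|k IH]; intros w Hw; [now apply HW|].
  apply in_extend in Hw. destruct Hw as (a & v & -> & Hv & _). simpl. now rewrite IH.
Qed.

(** Weigh a word by [u] at its latest letter: summing over the allowed next letters replaces [u] by
    [A u <= t u]. As [u] is bounded below, this bounds the number of paths by a multiple of
    [t ^ k]. *)
Lemma extend_iter_weight (fs : list Mob) (t : R) (u : nat -> R) (W : list (list nat)) (k : nat) :
  0 < t -> supersol (length fs) (adj fs) t u ->
  (forall w, In w W -> (hd 0%nat w < length fs)%nat) ->
  let Wk := extend_iter (length fs) (edgeb fs) k W in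
  (forall w, In w Wk -> (hd 0%nat w < length fs)%nat) /\
  lsum (fun w => u (hd 0%nat w)) Wk <= t ^ k * lsum (fun w => u (hd 0%nat w)) W.
Proof.
  intros Ht Hu HW. induction k as [|k [IH1 IH2]]; simpl.
  - split; [exact HW|lra].
  - split.
    + intros w Hw. apply in_extend in Hw. destruct Hw as (a & v & -> & _ & Ha & _). exact Ha.
    + apply Rle_trans with
        (t * lsum (fun w => u (hd 0%nat w)) (extend_iter (length fs) (edgeb fs) k W)).
      2:{ rewrite Rmult_assoc. apply Rmult_le_compat_l; [lra|exact IH2]. }
      unfold extend at 1. rewrite lsum_flat_map, <- lsum_scal.
      apply lsum_le. intros w Hw. rewrite lsum_map, lsum_filter. simpl.
      destruct (Hu _ (IH1 w Hw)) as [_ H]. unfold mulvec in H.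
      erewrite lsum_ext; [apply Rle_trans with (2 := H); apply Rlt_le, Rlt_plus_1|].
      intros a _. unfold edgeb, adj. now destruct excluded_middle_informative.
Qed.

Lemma Rpower_inv_pow (b s : R) (m : nat) : 0 < b -> Rpower (/ b ^ m) s = (/ Rpower b s) ^ m.
Proof.
  intros Hb. assert (Hp : 0 < Rpower b s) by apply exp_pos.
  assert (H1 : Rpower 1 s = 1) by (unfold Rpower; rewrite ln_1, Rmult_0_r; apply exp_0).
  assert (Hi : Rpower (/ b) s = / Rpower b s).
  { apply Rmult_eq_reg_l with (Rpower b s); [|lra].
    rewrite Rpower_mult_distr by (auto using Rinv_0_lt_compat).
    now rewrite !Rinv_r, H1 by lra. }
  induction m as [|m IH]; simpl; [now rewrite Rinv_1|].
  rewrite <- IH, <- Hi, Rpower_mult_distr.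
  - f_equal. apply Rinv_mult.
  - now apply Rinv_0_lt_compat.
  - now apply Rinv_0_lt_compat, pow_lt.
Qed.

Lemma pow_eventually_le (q c eps : R) :
  0 <= q < 1 -> 0 <= c -> 0 < eps ->
  exists N, forall k, (N <= k)%nat -> c * q ^ k <= eps.
Proof.
  intros Hq Hc He.
  destruct (pow_lt_1_zero q) with (y := eps / (c + 1)) as (N & HN).
  - rewrite Rabs_pos_eq; lra.
  - apply Rdiv_lt_0_compat; lra.
  - exists N. intros k Hk. specialize (HN k Hk).
    assert (Hp : 0 <= q ^ k) by now apply pow_le.
    rewrite Rabs_pos_eq in HN by exact Hp. apply Rlt_div_r in HN; [|lra]. nra.
Qed.

Lemma eventual_paths_finite_covers (fs : list Mob) (s t : R) (u : nat -> R) (L : nat) :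
  (2 <= length fs)%nat -> 0 < s -> supersol (length fs) (adj fs) t u ->
  t < Rpower (INR (length fs)) s ->
  finite_covers (length fs) s
    (fun x => in_Omega (length fs) x /\ forall i, (L <= i)%nat -> tedge fs (x i) (x (S i))).
Proof.
  set (n := length fs). intros Hn Hs Hu Htp delta eps Hd He.
  assert (Hb : 2 <= INR n) by (change 2 with (INR 2); apply le_INR; lia).
  assert (Ht : 0 < t) by (apply (supersol_pos n (adj fs) t u); [apply adj_nonneg|lia|exact Hu]).
  set (p := Rpower (INR n) s) in *.
  assert (Hp : 0 < p) by apply exp_pos.
  (* The first [S L] letters are free: the first constrained step goes from [x L] to [x (S L)], so
     [x L] must belong to the prefix. *)
  set (W0 := extend_iter n (fun _ _ => true) (S L) (nil :: nil)).
  assert (HW0 : forall w, In w W0 -> (hd 0%nat w < n)%nat).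
  { intros w Hw. apply in_extend in Hw. destruct Hw as (a & v & -> & _ & Ha & _). exact Ha. }
  assert (HW0l : forall w, In w W0 -> length w = S L).
  { intros w Hw. rewrite (extend_iter_length n (fun _ _ => true) (nil :: nil) 0 (S L)); [lia| |exact Hw].
    intros v [<-|[]]; easy. }
  set (D := lsum (fun w => u (hd 0%nat w)) W0).
  assert (HD : 0 <= D).
  { apply lsum_nonneg. intros w Hw. apply Hu. now apply HW0. }
  (* With this [c], the total weight of the cylinders of length [k + S L] is at most
     [c * (t / p) ^ k]. *)
  set (c := t * D * (/ p) ^ S L).
  assert (Hip : 0 < / p) by now apply Rinv_0_lt_compat.
  assert (Hc : 0 <= c).
  { unfold c. apply Rmult_le_pos; [nra|]. apply pow_le; lra. }
  destruct (pow_eventually_le (t / p) c eps) as (N1 & HN1); auto.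
  { split; [apply Rdiv_le_0_compat; lra|]. apply Rlt_div_l; lra. }
  destruct (pow_eventually_le (/ INR n) 1 delta) as (N2 & HN2); auto; [|lra|].
  { split; [apply Rlt_le, Rinv_0_lt_compat; lra|].
    rewrite <- Rinv_1. apply Rinv_lt_contravar; lra. }
  set (k := Nat.max N1 N2).
  set (Wk := extend_iter n (edgeb fs) k W0).
  assert (HWl : forall w, In w Wk -> length w = (k + S L)%nat)
    by now apply extend_iter_length.
  destruct (extend_iter_weight fs t u W0 k Ht Hu HW0) as [HWk1 HWk2].
  fold n in HWk1, HWk2. fold Wk in HWk1, HWk2. fold D in HWk2.
  set (cyl := fun (w : list nat) (x : nat -> nat) =>
                in_Omega n x /\ rword x (length w) = w).
  assert (Hdiam : forall w, In w Wk -> diam n (cyl w) <= / INR n ^ (k + S L)).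
  { intros w Hw. apply diam_le; [lia| |].
    - apply Rlt_le, Rinv_0_lt_compat, pow_lt; lra.
    - intros x y [_ Hx] [_ Hy]. rewrite <- (HWl w Hw). apply dist_agree_le; [lia|].
      apply rword_agree. now rewrite Hx, Hy. }
  exists (map cyl Wk). split; [|split].
  - intros U HU. apply in_map_iff in HU. destruct HU as (w & <- & Hw). split.
    + intros x Hx. apply Hx.
    + apply Rle_trans with (1 := Hdiam w Hw). rewrite <- pow_inv.
      apply Rle_trans with (2 := HN2 (k + S L)%nat ltac:(lia)). lra.
  - intros x [Hx HL]. exists (cyl (rword x (k + S L))). split.
    + apply in_map. apply extend_iter_rword.
      * exact Hx.
      * replace (S L) with (S L + 0)%nat by lia.
        apply extend_iter_rword; auto; now left.
      * intros i Hi. simpl. unfold edgeb.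
        destruct excluded_middle_informative as [|E]; [easy|]. elim E. apply HL; lia.
      * discriminate.
    + split; [exact Hx|]. now rewrite rword_length.
  - rewrite lsum_map.
    (* The factor [t * u (hd 0 w)], at least 1, turns the count of words into the weight controlled
       above. *)
    apply Rle_trans with (lsum (fun w => Rpower (/ INR n ^ (k + S L)) s * (t * u (hd 0%nat w))) Wk).
    + apply lsum_le. intros w Hw.
      assert (H1 := supersol_ge n (adj fs) t u _ (adj_nonneg fs) Hu (HWk1 w Hw)).
      assert (Hpos : 0 < Rpower (/ INR n ^ (k + S L)) s) by apply exp_pos.
      assert (H2 : diam_pow n (cyl w) s <= Rpower (/ INR n ^ (k + S L)) s).
      { apply diam_pow_le; [lia|exact Hs| |now apply Hdiam].
        apply Rinv_0_lt_compat, pow_lt; lra. }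
      nra.
    + rewrite lsum_scal, lsum_scal, Rpower_inv_pow by lra. fold p.
      apply Rle_trans with ((/ p) ^ (k + S L) * (t * (t ^ k * D))).
      { apply Rmult_le_compat_l; [apply pow_le; lra|]. apply Rmult_le_compat_l; [lra|exact HWk2]. }
      apply Rle_trans with (2 := HN1 k ltac:(lia)). right. unfold c, Rdiv.
      rewrite Rpow_mult_distr, pow_add. ring.
Qed.

(** * The Markov measure and the lower bound for the dimension *)

Lemma term_le_Series (a : nat -> R) (i : nat) :
  (forall j, 0 <= a j) -> ex_series a -> a i <= Series a.
Proof.
  intros Ha He. apply Series_correct in He. apply is_series_Reals in He.
  apply Rle_trans with (sum_f_R0 a i).
  - destruct i as [|i]; [simpl; lra|]. rewrite tech5.
    assert (H := cond_pos_sum a i Ha). lra.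
  - now apply sum_incr.
Qed.

Lemma Series_zero : Series (fun _ => 0) = 0.
Proof.
  rewrite (Series_ext _ (fun _ => 0 * 0)) by (intros; ring). rewrite Series_scal_l. ring.
Qed.

Lemma Series_lsum {A : Type} (f : A -> nat -> R) (l : list A) :
  (forall a, In a l -> ex_series (f a)) ->
  ex_series (fun i => lsum (fun a => f a i) l) /\
  Series (fun i => lsum (fun a => f a i) l) = lsum (fun a => Series (f a)) l.
Proof.
  induction l as [|a l IH]; intros H.
  - split.
    + apply (ex_series_ext (fun i => 0 * (/ 2) ^ i)); [intros; simpl; ring|].
      apply (ex_series_scal_l 0 (fun i => (/ 2) ^ i)). apply ex_series_geom.
      rewrite Rabs_pos_eq; lra.
    + simpl. apply Series_zero.
  - destruct IH as [IH1 IH2]; [intros; apply H; now right|]. simpl. split.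
    + apply (ex_series_plus (f a) _ (H a (or_introl eq_refl)) IH1).
    + rewrite Series_plus, IH2; auto. apply H; now left.
Qed.

Fixpoint path_weight (A : nat -> nat -> R) (r : R) (w : list nat) : R :=
  match w with
  | nil => 1
  | a :: w' => match w' with nil => 1 | b :: _ => A b a * / r * path_weight A r w' end
  end.

(* The Markov measure of the cylinder with reversed word [w]: additivity over the next
   letter is the eigenvector equation for [v]. *)
Definition mass (A : nat -> nat -> R) (r : R) (v : nat -> R) (w : list nat) : R :=
  match w with nil => 1 | a :: _ => path_weight A r w * v a end.

(** A nonempty word of length [k] has [k - 1] transitions, which accounts for the extra factor
    [r]. *)
Lemma path_weight_bounds (A : nat -> nat -> R) (r : R) (w : list nat) :
  (forall i j, 0 <= A i j <= 1) -> 1 <= r ->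
  0 <= path_weight A r w <= r * (/ r) ^ length w.
Proof.
  intros HA Hr. assert (Hi : 0 < / r) by (apply Rinv_0_lt_compat; lra).
  induction w as [|a w IH]; [simpl; lra|]. destruct w as [|b w].
  - simpl. rewrite Rmult_1_r, Rinv_r; lra.
  - change (path_weight A r (a :: b :: w)) with (A b a * / r * path_weight A r (b :: w)).
    change (length (a :: b :: w)) with (S (length (b :: w))).
    set (q := path_weight A r (b :: w)) in *. set (m := length (b :: w)) in *.
    destruct (HA b a) as [H0 H1].
    assert (Hq : 0 <= / r * q) by (apply Rmult_le_pos; lra).
    rewrite <- tech_pow_Rmult. split; [rewrite Rmult_assoc; now apply Rmult_le_pos|].
    apply Rle_trans with (/ r * q); [rewrite Rmult_assoc; nra|].
    replace (r * (/ r * (/ r) ^ m)) with (/ r * (r * (/ r) ^ m)) by ring.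
    apply Rmult_le_compat_l; lra.
Qed.

Lemma mass_bounds (A : nat -> nat -> R) (r : R) (v : nat -> R) (w : list nat) :
  (forall i j, 0 <= A i j <= 1) -> 1 <= r -> (forall i, 0 <= v i <= 1) ->
  0 <= mass A r v w <= r * (/ r) ^ length w.
Proof.
  intros HA Hr Hv. destruct w as [|a w]; [simpl; lra|].
  assert (H := path_weight_bounds A r (a :: w) HA Hr). specialize (Hv a).
  unfold mass. nra.
Qed.

Lemma mass_additive (n : nat) (A : nat -> nat -> R) (r : R) (v : nat -> R) (w : list nat) :
  r <> 0 -> lsum v (seq 0 n) = 1 ->
  (forall i, (i < n)%nat -> mulvec n A v i = r * v i) ->
  (w = nil \/ (hd 0%nat w < n)%nat) ->
  lsum (fun a => mass A r v (a :: w)) (seq 0 n) = mass A r v w.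
Proof.
  intros Hr Hs Hv Hw. destruct w as [|b w].
  - transitivity (lsum v (seq 0 n)); [|exact Hs]. apply lsum_ext; intros; simpl; ring.
  - destruct Hw as [Hw|Hw]; [easy|]. simpl in Hw.
    rewrite (lsum_ext _ (fun a => (/ r * path_weight A r (b :: w)) * (A b a * v a)))
      by (intros a _; change (mass A r v (a :: b :: w))
            with (A b a * / r * path_weight A r (b :: w) * v a); ring).
    rewrite lsum_scal. change (lsum _ _) with (mulvec n A v b). rewrite Hv by exact Hw.
    unfold mass. now field.
Qed.

(* Mass of the intersection of two cylinders: it is empty unless one word extends the
   other, which for reversed words means being a suffix of it. *)
Definition meet_mass (A : nat -> nat -> R) (r : R) (v : nat -> R) (c w : list nat) : R :=
  if Nat.leb (length w) (length c) then
    if list_eq_dec Nat.eq_dec (skipn (length c - length w) c) w then mass A r v c else 0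
  else
    if list_eq_dec Nat.eq_dec (skipn (length w - length c) w) c then mass A r v w else 0.

Lemma meet_mass_nonneg (A : nat -> nat -> R) (r : R) (v : nat -> R) (c w : list nat) :
  (forall w, 0 <= mass A r v w) -> 0 <= meet_mass A r v c w.
Proof.
  intros H. unfold meet_mass. destruct Nat.leb; destruct list_eq_dec; auto; lra.
Qed.

Lemma meet_mass_nil (A : nat -> nat -> R) (r : R) (v : nat -> R) (c : list nat) :
  meet_mass A r v c nil = mass A r v c.
Proof.
  unfold meet_mass. simpl. rewrite Nat.sub_0_r, skipn_all.
  now destruct list_eq_dec.
Qed.

Lemma meet_mass_self (A : nat -> nat -> R) (r : R) (v : nat -> R) (c : list nat) :
  meet_mass A r v c c = mass A r v c.
Proof.
  unfold meet_mass. rewrite Nat.leb_refl, Nat.sub_diag. simpl.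
  now destruct list_eq_dec.
Qed.

Lemma lsum_indicator_le (c : R) (a0 : nat) (l : list nat) :
  0 <= c -> NoDup l -> lsum (fun a => if Nat.eq_dec a0 a then c else 0) l <= c.
Proof.
  intros Hc Hl. induction Hl as [|a l Ha Hl IH]; simpl; [exact Hc|].
  destruct (Nat.eq_dec a0 a) as [->|Hne]; [|lra].
  rewrite (lsum_ext _ (fun _ => 0)), lsum_zero; [lra|].
  intros b Hb. destruct Nat.eq_dec as [->|]; [contradiction|easy].
Qed.

(** While [w] is shorter than [c], at most one extension [a :: w] can still be a suffix of [c],
    namely with [a = a0], which may lie outside the alphabet. Once [w] is as long as [c], all
    extensions behave like [w] and [Hadd] applies. *)
Lemma meet_mass_subadditive (n : nat) (A : nat -> nat -> R) (r : R) (v : nat -> R)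
  (c w : list nat) :
  (forall w, 0 <= mass A r v w) ->
  lsum (fun a => mass A r v (a :: w)) (seq 0 n) = mass A r v w ->
  lsum (fun a => meet_mass A r v c (a :: w)) (seq 0 n) <= meet_mass A r v c w.
Proof.
  intros Hm Hadd. unfold meet_mass at 1.
  change (length (_ :: w)) with (S (length w)).
  destruct (Nat.lt_ge_cases (length w) (length c)) as [Hlt|Hge].
  - assert (E1 : Nat.leb (S (length w)) (length c) = true) by (apply Nat.leb_le; lia).
    assert (E2 : Nat.leb (length w) (length c) = true) by (apply Nat.leb_le; lia).
    unfold meet_mass. rewrite E2.
    assert (Hc : exists a0, skipn (length c - S (length w)) c =
                            a0 :: skipn (length c - length w) c).
    { replace (length c - length w)%nat with (1 + (length c - S (length w)))%nat by lia.
      rewrite <- skipn_skipn.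
      assert (Hl : length (skipn (length c - S (length w)) c) = S (length w))
        by (rewrite length_skipn; lia).
      destruct (skipn (length c - S (length w)) c) as [|a0 c']; [easy|]. now exists a0. }
    destruct Hc as (a0 & Hc).
    destruct (list_eq_dec Nat.eq_dec (skipn (length c - length w) c) w) as [E|E].
    + eapply Rle_trans; [|apply (lsum_indicator_le (mass A r v c) a0 (seq 0 n)); [auto|apply seq_NoDup]].
      right. apply lsum_ext. intros a _. rewrite E1, Hc, E.
      destruct list_eq_dec as [E3|E3], Nat.eq_dec as [E4|E4]; try easy.
      * injection E3; contradiction.
      * elim E3. now rewrite E4.
    + right. rewrite (lsum_ext _ (fun _ => 0)), lsum_zero; [easy|].
      intros a _. rewrite E1, Hc. destruct list_eq_dec as [E3|E3]; [|easy].
      injection E3; contradiction.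
  - assert (E1 : Nat.leb (S (length w)) (length c) = false) by (apply Nat.leb_gt; lia).
    apply Rle_trans with
      (if list_eq_dec Nat.eq_dec (skipn (length w - length c) w) c then mass A r v w else 0).
    + right.
      rewrite (lsum_ext _ (fun a =>
        (if list_eq_dec Nat.eq_dec (skipn (length w - length c) w) c then 1 else 0) *
        mass A r v (a :: w))).
      * rewrite lsum_scal, Hadd. destruct list_eq_dec; ring.
      * intros a _. rewrite E1.
        replace (S (length w) - length c)%nat with (S (length w - length c)) by lia.
        simpl skipn. destruct list_eq_dec; ring.
    + right. unfold meet_mass.
      destruct (Nat.leb (length w) (length c)) eqn:E2; [|easy].
      apply Nat.leb_le in E2. replace (length w - length c)%nat with 0%nat by lia.
      replace (length c - length w)%nat with 0%nat by lia. simpl.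
      destruct list_eq_dec as [->|E3], list_eq_dec as [E4|E4]; try easy. now elim E3.
Qed.

(* A greedy choice of letters keeps the covered part of the mass of the current cylinder
   strictly below its total mass. *)
Lemma uncovered_path (n : nat) (A : nat -> nat -> R) (r : R) (v : nat -> R)
  (c : nat -> list nat) :
  (forall i j, 0 <= A i j <= 1) -> 1 <= r -> (forall i, 0 <= v i <= 1) ->
  lsum v (seq 0 n) = 1 -> (forall i, (i < n)%nat -> mulvec n A v i = r * v i) ->
  ex_series (fun i => mass A r v (c i)) -> Series (fun i => mass A r v (c i)) < 1 ->
  exists x, in_Omega n x /\ (forall k, A (x k) (x (S k)) <> 0) /\
            forall i, rword x (length (c i)) <> c i.
Proof.
  intros HA Hr Hv Hs Heig Hex Hlt.
  assert (Hm : forall w, 0 <= mass A r v w) by (intros w; now apply mass_bounds).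
  set (Inv := fun w => (w = nil \/ (hd 0%nat w < n)%nat) /\
                ex_series (fun i => meet_mass A r v (c i) w) /\
                Series (fun i => meet_mass A r v (c i) w) < mass A r v w).
  assert (Hnil : Inv nil).
  { split; [now left|]. split.
    - apply (ex_series_ext (fun i => mass A r v (c i))); [|exact Hex].
      intros; now rewrite meet_mass_nil.
    - rewrite (Series_ext _ (fun i => mass A r v (c i))); [exact Hlt|].
      intros; now rewrite meet_mass_nil. }
  assert (Hstep : forall w, exists a, Inv w -> (a < n)%nat /\ Inv (a :: w)).
  { intros w. destruct (classic (Inv w)) as [HI|]; [|exists 0%nat; contradiction].
    destruct HI as (Hw & He & Hl). apply NNPP; intros Hn.
    assert (Hadd : lsum (fun a => mass A r v (a :: w)) (seq 0 n) = mass A r v w).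
    { apply mass_additive; auto. lra. }
    assert (Hsub : forall i, lsum (fun a => meet_mass A r v (c i) (a :: w)) (seq 0 n) <=
                             meet_mass A r v (c i) w)
      by (intros; now apply meet_mass_subadditive).
    assert (Hexa : forall a, In a (seq 0 n) ->
              ex_series (fun i => meet_mass A r v (c i) (a :: w))).
    { intros a Ha. apply (ex_series_le (V := R_CompleteNormedModule)
        (fun i => meet_mass A r v (c i) (a :: w)) (fun i => meet_mass A r v (c i) w)); [|exact He].
      intros i. change (Rabs (meet_mass A r v (c i) (a :: w)) <= meet_mass A r v (c i) w).
      rewrite Rabs_pos_eq by now apply meet_mass_nonneg.
      apply Rle_trans with (2 := Hsub i).
      apply (lsum_term_le (fun a => meet_mass A r v (c i) (a :: w))); [|exact Ha].
      intros; now apply meet_mass_nonneg. }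
    destruct (Series_lsum (fun a i => meet_mass A r v (c i) (a :: w)) (seq 0 n) Hexa) as [_ E].
    assert (H1 : lsum (fun a => Series (fun i => meet_mass A r v (c i) (a :: w))) (seq 0 n)
                 < mass A r v w).
    { rewrite <- E. eapply Rle_lt_trans; [|exact Hl]. apply Series_le; [|exact He].
      intros i. split; [|apply Hsub]. apply lsum_nonneg; intros; now apply meet_mass_nonneg. }
    (* If every letter failed, each extension would be covered at least to its full mass, and
       summing over letters would contradict [H1]. *)
    apply (Rlt_not_le _ _ H1). rewrite <- Hadd. apply lsum_le.
    intros a Ha. apply Rnot_lt_le; intros Hlt'. apply Hn. exists a. intros _.
    assert (Ha' := Ha). apply in_seq in Ha'. split; [lia|]. split; [right; simpl; lia|].
    split; [now apply Hexa|exact Hlt']. }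
  apply functional_choice in Hstep; destruct Hstep as (g & Hg).
  set (W := fix W k := match k with O => nil | S j => g (W j) :: W j end).
  assert (HW : forall k, Inv (W k)).
  { induction k as [|k IH]; [exact Hnil|]. exact (proj2 (Hg (W k) IH)). }
  set (x := fun k => g (W k)).
  assert (Hxw : forall k, rword x k = W k).
  { induction k as [|k IH]; [easy|]. simpl. now rewrite IH. }
  (* The covered part is nonnegative and strictly below the mass. Positive mass in turn forces every
     transition to have nonzero [A]. *)
  assert (Hpos : forall k, 0 < mass A r v (W k)).
  { intros k. destruct (HW k) as (_ & He & Hl). apply Rle_lt_trans with (2 := Hl).
    rewrite <- Series_zero. apply Series_le; [|exact He].
    intros i. split; [lra|now apply meet_mass_nonneg]. }
  exists x. split; [|split].
  - intros k. exact (proj1 (Hg (W k) (HW k))).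
  - intros k E. specialize (Hpos (S (S k))). rewrite <- Hxw in Hpos.
    simpl in Hpos. rewrite E in Hpos. lra.
  (* If the path entered the cylinder of [c i], the term [i] alone would cover the full mass at that
     level. *)
  - intros i E. destruct (HW (length (c i))) as (_ & He & Hl).
    rewrite <- Hxw, E in He, Hl.
    assert (H := term_le_Series (fun j => meet_mass A r v (c j) (c i)) i
                   ltac:(intros; now apply meet_mass_nonneg) He).
    cbv beta in H. rewrite meet_mass_self in H. lra.
Qed.

(** The mass distribution principle. Each covering set lies in a cylinder of mass at most
    [r * p * diam^s] plus an error [/ 4 * (/ 2) ^ S i]; both parts sum to at most [/ 4], so the
    total mass stays below 1 and some path is not covered. *)
Lemma paths_not_null (n : nat) (A : nat -> nat -> R) (r s : R) (v : nat -> R)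
  (E : (nat -> nat) -> Prop) :
  (2 <= n)%nat -> (forall i j, 0 <= A i j <= 1) -> (forall i, 0 <= v i <= 1) ->
  lsum v (seq 0 n) = 1 -> (forall i, (i < n)%nat -> mulvec n A v i = r * v i) ->
  0 <= s -> Rpower (INR n) s < r ->
  (forall x, in_Omega n x -> (forall k, A (x k) (x (S k)) <> 0) -> E x) ->
  ~ hausdorff_null n s E.
Proof.
  intros Hn HA Hv Hs Heig Hs0 Hpr HE Hnull.
  assert (Hb : 2 <= INR n) by (change 2 with (INR 2); apply le_INR; lia).
  set (p := Rpower (INR n) s) in *.
  assert (Hp1 : 1 <= p).
  { rewrite <- (Rpower_O (INR n)) by lra. apply Rle_Rpower; lra. }
  assert (Hrp : 0 < 4 * (r * p)) by nra.
  destruct (Hnull 1 (/ (4 * (r * p)))) as (U & HU & _ & Hcov & l & Hl & Hle);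
    [lra|now apply Rinv_0_lt_compat|].
  assert (Hir : 0 < / r < 1).
  { split; [apply Rinv_0_lt_compat; lra|]. rewrite <- Rinv_1. apply Rinv_lt_contravar; lra. }
  assert (Hc : forall i, exists c, (forall x, U i x -> rword x (length c) = c) /\
     mass A r v c <= r * p * diam_pow n (U i) s + / 4 * (/ 2) ^ S i).
  { intros i. assert (Hi : 0 < / 4 * (/ 2) ^ S i).
    { apply Rmult_lt_0_compat; [lra|apply pow_lt; lra]. }
    assert (Hdp := diam_pow_nonneg n (U i) s).
    assert (Hrdp : 0 <= r * p * diam_pow n (U i) s) by (apply Rmult_le_pos; nra).
    (* Empty sets and singletons, where [diam_pow] can be 0: a long enough cylinder has mass below
       the error term. *)
    assert (Hsmall : forall y, (forall x, U i x -> forall j, x j = y j) ->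
      exists c, (forall x, U i x -> rword x (length c) = c) /\
         mass A r v c <= r * p * diam_pow n (U i) s + / 4 * (/ 2) ^ S i).
    { intros y Hy. destruct (pow_eventually_le (/ r) r _ ltac:(lra) ltac:(lra) Hi) as (K & HK).
      exists (rword y K). split.
      - intros x Hx. rewrite rword_length. apply rword_ext. intros j _. now apply Hy.
      - assert (H := mass_bounds A r v (rword y K) HA ltac:(lra) Hv).
        rewrite rword_length in H. specialize (HK K (le_n _)). lra. }
    destruct (classic (exists y, U i y)) as [(y & Hy)|Hemp].
    2:{ apply (Hsmall (fun _ => 0%nat)). intros x Hx. elim Hemp; eauto. }
    assert (Hd := diam_nonneg n (U i) ltac:(lia)).
    destruct (Req_dec (diam n (U i)) 0) as [E0|E0].
    { apply (Hsmall y). intros x Hx. apply (diam_zero_eq n (U i)); auto; lia. }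
    destruct (subset_cylinder n (U i) y) as (k & Hk & Hkd); [lia|exact Hy|lra|].
    exists (rword y k). split.
    - intros x Hx. rewrite rword_length. apply rword_ext. now apply Hk.
    - assert (H := mass_bounds A r v (rword y k) HA ltac:(lra) Hv).
      rewrite rword_length in H.
      rewrite (diam_pow_pos_eq n (U i) s y) in * by (exact Hy || lra).
      (* The comparison [r^-k <= p^-k = (n^-k)^s <= (n * diam)^s = p * diam^s], where [p < r]
         enters. *)
      assert (H1 : (/ r) ^ k <= (/ p) ^ k).
      { apply pow_incr. split; [lra|]. apply Rinv_le_contravar; lra. }
      assert (H2 : (/ p) ^ k <= p * Rpower (diam n (U i)) s).
      { unfold p at 2. rewrite Rpower_mult_distr by lra. unfold p. rewrite <- Rpower_inv_pow by lra.
        apply Rle_Rpower_l; [exact Hs0|]. split; [|exact Hkd].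
        apply Rinv_0_lt_compat, pow_lt; lra. }
      assert (H3 : r * (/ r) ^ k <= r * (p * Rpower (diam n (U i)) s))
        by (apply Rmult_le_compat_l; lra).
      lra. }
  apply functional_choice in Hc; destruct Hc as (c & Hc).
  assert (Hm : forall i, 0 <= mass A r v (c i)) by (intros i; apply mass_bounds; auto; lra).
  destruct (infinite_sum_bounded (fun i => mass A r v (c i)) (/ 2)) as (l' & Hl' & Hle').
  { exact Hm. }
  { intros N. rewrite lsum_seq.
    apply Rle_trans with (lsum (fun i => r * p * diam_pow n (U i) s + / 4 * (/ 2) ^ S i) (seq 0 (S N))).
    - apply lsum_le. intros i _. apply Hc.
    - rewrite lsum_plus, lsum_geom_half, lsum_scal, <- lsum_seq.
      assert (H1 : sum_f_R0 (fun i => diam_pow n (U i) s) N <= l).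
      { apply sum_incr; [exact Hl|]. intros; apply diam_pow_nonneg. }
      assert (H2 : r * p * sum_f_R0 (fun i => diam_pow n (U i) s) N <= / 4).
      { apply Rle_trans with (r * p * / (4 * (r * p))).
        - apply Rmult_le_compat_l; nra.
        - right. field. split; lra. }
      assert (H3 : 0 < (/ 2) ^ S N) by (apply pow_lt; lra). lra. }
  apply is_series_Reals in Hl'.
  destruct (uncovered_path n A r v c) as (x & Hx & Hpath & Hnc); auto.
  - lra.
  - now exists l'.
  - rewrite (is_series_unique _ _ Hl'). lra.
  - destruct (Hcov x (HE x Hx Hpath)) as (i & Hi). apply (Hnc i). now apply (Hc i).
Qed.

(** * Assembly of the dimension formula *)

Lemma eventual_edges_cycle (fs : list Mob) (x : nat -> nat) (L : nat) :
  in_Omega (length fs) x -> (forall i, (L <= i)%nat -> tedge fs (x i) (x (S i))) ->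
  has_cycle fs.
Proof.
  intros Hx HL. apply NNPP; intros Hn. set (n := length fs) in *.
  assert (Hinj : forall i j, (L <= i < j)%nat -> x i <> x j).
  { intros i j Hij E. apply Hn. exists (fun k => x (i + k)%nat), (j - i)%nat.
    split; [lia|]. split; [|split].
    - rewrite Nat.add_0_r, E. f_equal. lia.
    - intros k _. apply Hx.
    - intros k Hk. replace (i + k)%nat with (S (i + (k - 1)))%nat by lia. apply HL; lia. }
  (* Pigeonhole: a repeated letter beyond [L] closes a cycle, so without one [n + 1] consecutive
     letters would be distinct among [n] values. *)
  assert (Hnd : NoDup (map x (seq L (S n)))).
  { apply NoDup_map_NoDup_ForallPairs; [|apply seq_NoDup].
    intros i j Hi Hj E. apply in_seq in Hi, Hj.
    destruct (Nat.lt_trichotomy i j) as [H|[H|H]]; [|exact H|].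
    - now elim (Hinj i j ltac:(lia)).
    - symmetry in E. now elim (Hinj j i ltac:(lia)). }
  assert (Hle : (length (map x (seq L (S n))) <= length (seq 0 n))%nat).
  { apply NoDup_incl_length; [exact Hnd|]. intros a Ha. apply in_map_iff in Ha.
    destruct Ha as (i & <- & _). apply in_seq. specialize (Hx i). lia. }
  rewrite length_map, !length_seq in Hle. lia.
Qed.

Lemma hausdorff_null_empty (n : nat) (s : R) (E : (nat -> nat) -> Prop) :
  (forall x, ~ E x) -> hausdorff_null n s E.
Proof.
  intros HE delta eps Hd He. exists (fun _ _ => False).
  assert (Hemp : ~ exists x : nat -> nat, False) by (intros (_ & [])).
  split; [easy|]. split; [intros i; rewrite diam_empty; [lra|exact Hemp]|].
  split; [intros x Hx; elim (HE x Hx)|].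
  destruct (infinite_sum_bounded (fun _ => diam_pow n (fun _ => False) s) 0) as (l & Hl & Hle).
  - intros; apply diam_pow_nonneg.
  - intros N. rewrite lsum_seq, (lsum_ext _ (fun _ => 0)), lsum_zero; [lra|].
    intros; now apply diam_pow_empty.
  - exists l. split; [exact Hl|lra].
Qed.

Lemma hausdorff_null_one_letter (s : R) (E : (nat -> nat) -> Prop) :
  0 < s -> (forall x, E x -> in_Omega 1 x) -> hausdorff_null 1 s E.
Proof.
  intros Hs HE delta eps Hd He. exists (fun _ => in_Omega 1).
  assert (Hdiam : diam 1 (in_Omega 1) = 0).
  { apply Rle_antisym; [|apply diam_nonneg; lia]. apply diam_le; [lia|lra|].
    intros x y Hx Hy. destruct (dist_specP 1 x y) as [[_ ->]|(k & _ & Hne & _)]; [lra|].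
    elim Hne. specialize (Hx k); specialize (Hy k). lia. }
  split; [easy|]. split; [intros _; rewrite Hdiam; lra|].
  split; [intros x Hx; exists 0%nat; now apply HE|].
  destruct (infinite_sum_bounded (fun _ => diam_pow 1 (in_Omega 1) s) 0) as (l & Hl & Hle).
  - intros; apply diam_pow_nonneg.
  - intros N. rewrite lsum_seq, (lsum_ext _ (fun _ => 0)), lsum_zero; [lra|].
    intros _ _. unfold diam_pow. destruct excluded_middle_informative; [|easy].
    destruct Req_dec_T; [|easy]. destruct Req_dec_T; lra.
  - exists l. split; [exact Hl|lra].
Qed.

Lemma eventual_paths_null (fs : list Mob) (s t : R) (u : nat -> R)
  (E : (nat -> nat) -> Prop) :
  (2 <= length fs)%nat -> 0 < s -> supersol (length fs) (adj fs) t u ->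
  t < Rpower (INR (length fs)) s ->
  (forall x, E x -> in_Omega (length fs) x /\
     exists L, forall i, (L <= i)%nat -> tedge fs (x i) (x (S i))) ->
  hausdorff_null (length fs) s E.
Proof.
  intros Hn Hs Hu Ht HE.
  apply hausdorff_null_countable_union with
    (F := fun L x => in_Omega (length fs) x /\
                     forall i, (L <= i)%nat -> tedge fs (x i) (x (S i))).
  - intros L. now apply eventual_paths_finite_covers with t u.
  - intros x Hx. destruct (HE x Hx) as (H1 & L & H2). now exists L.
Qed.

Lemma paths_not_null_below_spectral_radius (fs : list Mob) (s : R) (E : (nat -> nat) -> Prop) :
  (2 <= length fs)%nat -> 0 <= s ->
  Rpower (INR (length fs)) s < spectral_radius fs ->
  (forall x, in_Omega (length fs) x -> (forall i, tedge fs (x i) (x (S i))) -> E x) ->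
  ~ hausdorff_null (length fs) s E.
Proof.
  intros Hn Hs Hlt HE. set (n := length fs) in *.
  destruct (spectral_radius_perron fs) as (v & _ & Hv0 & Hv1 & Hv); [fold n; lia|].
  (* The eigenvector is cut off to 0 outside the alphabet, because the mass bounds concern all
     indices. *)
  fold n in Hv0, Hv1, Hv. set (v' := fun i => if Nat.ltb i n then v i else 0).
  assert (Hvv : forall i, (i < n)%nat -> v' i = v i).
  { intros i Hi. unfold v'. now rewrite (proj2 (Nat.ltb_lt i n) Hi). }
  apply (paths_not_null n (adj fs) (spectral_radius fs) s v'); auto.
  - intros i j. unfold adj. destruct excluded_middle_informative; lra.
  - intros i. destruct (Nat.lt_ge_cases i n) as [Hi|Hi].
    + rewrite Hvv by exact Hi. split; [now apply Hv0|]. rewrite <- Hv1.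
      apply lsum_term_le; [|apply in_seq; lia].
      intros j Hj; apply in_seq in Hj. apply Hv0; lia.
    + unfold v'. rewrite (proj2 (Nat.ltb_ge i n) Hi). lra.
  - rewrite <- Hv1. apply lsum_ext. intros i Hi. apply in_seq in Hi. apply Hvv; lia.
  - intros i Hi. rewrite Hvv, <- Hv by exact Hi. unfold mulvec. apply lsum_ext.
    intros j Hj. apply in_seq in Hj. rewrite Hvv by lia. easy.
  - intros x Hx Hp. apply HE; [exact Hx|]. intros i. specialize (Hp i).
    unfold adj in Hp. now destruct excluded_middle_informative.
Qed.

Lemma lt_Rpower_iff_ln (b r s : R) : 1 < b -> 0 < r -> r < Rpower b s <-> ln r / ln b < s.
Proof.
  intros Hb Hr. assert (Hl : 0 < ln b) by (rewrite <- ln_1; apply ln_increasing; lra).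
  unfold Rpower. rewrite Rlt_div_l by exact Hl. split; intros H.
  - apply ln_increasing in H; [|exact Hr]. now rewrite ln_exp in H.
  - apply exp_increasing in H. now rewrite exp_ln in H.
Qed.

Lemma Rpower_lt_iff_ln (b r s : R) : 1 < b -> 0 < r -> Rpower b s < r <-> s < ln r / ln b.
Proof.
  intros Hb Hr. assert (Hl : 0 < ln b) by (rewrite <- ln_1; apply ln_increasing; lra).
  unfold Rpower. rewrite <- Rlt_div_r by exact Hl. split; intros H.
  - apply ln_increasing in H; [|apply exp_pos]. now rewrite ln_exp in H.
  - apply exp_increasing in H. now rewrite exp_ln in H.
Qed.

Theorem theorem1p3 (fs : list Mob) :
  (forall f, In f fs -> in_MD f) ->
  distinct_maps fs ->
  (forall f, In f fs -> gamma f < 1) ->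
  (has_cycle fs ->
     hdim_is (length fs) (Lambda fs)
       (ln (spectral_radius fs) / ln (INR (length fs)))) /\
  (~ has_cycle fs -> hdim_is (length fs) (Lambda fs) 0).
Proof.
  intros HM _ HG. assert (HF := family_has_normal_form fs HM HG).
  assert (HL : forall x, Lambda fs x -> in_Omega (length fs) x /\
            exists L, forall i, (L <= i)%nat -> tedge fs (x i) (x (S i))).
  { intros x [Hx Hd]. split; [exact Hx|]. now apply limit_disc_edges. }
  set (n := length fs) in *. split.
  - intros Hcyc.
    assert (Hn : (1 <= n)%nat).
    { destruct Hcyc as (p & m & _ & _ & Hp & _). specialize (Hp 0%nat ltac:(lia)).
      fold n in Hp. lia. }
    destruct (Nat.eq_dec n 1) as [E1|Hn1].
    { (* Junk value: division by [ln 1 = 0] gives [0], the dimension of a point. *)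
      rewrite E1 in *. simpl INR. rewrite ln_1. unfold Rdiv. rewrite Rinv_0, Rmult_0_r.
      split; [easy|]. intros w Hw. apply Rnot_lt_le; intros Hpos.
      enough (w <= w / 2) by lra. apply Hw; [lra|].
      apply hausdorff_null_one_letter; [lra|]. intros x Hx. now apply HL. }
    assert (Hb : 1 < INR n) by (change 1 with (INR 1); apply lt_INR; lia).
    destruct (spectral_radius_perron fs) as (_ & Hsup & _); [exact Hn|]. fold n in Hsup.
    assert (Hr : 1 <= spectral_radius fs).
    { apply Rnot_lt_le; intros Hlt.
      destruct (Hsup ((spectral_radius fs + 1) / 2)) as (u & Hu); [lra|].
      assert (H := supersol_cycle_gt_1 fs _ u Hcyc Hu). lra. }
    set (r := spectral_radius fs) in *. split.
    + intros s Hs Hnull. apply Rnot_lt_le; intros Hlt. revert Hnull.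
      apply paths_not_null_below_spectral_radius; [fold n; lia|exact Hs| |].
      * apply Rpower_lt_iff_ln; [exact Hb|fold r; lra|exact Hlt].
      * intros x Hx Hp. split; [exact Hx|]. now apply (edges_limit_disc fs x 0).
    + intros w Hw. apply Rnot_lt_le; intros Hlt.
      set (d := ln r / ln (INR n)) in *.
      assert (Hd : 0 <= d).
      { unfold d. apply Rdiv_le_0_compat.
        - rewrite <- ln_1. apply ln_le; lra.
        - rewrite <- ln_1. apply ln_increasing; lra. }
      (* The test exponent lies midway between [d] and [w]; the supersolution below is taken at a
         [t] midway between [r] and [n] to that exponent. *)
      enough (w <= (d + w) / 2) by lra. apply Hw; [lra|].
      assert (Hrp : r < Rpower (INR n) ((d + w) / 2)).
      { apply lt_Rpower_iff_ln; [exact Hb|lra|]. fold d. lra. }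
      destruct (Hsup ((r + Rpower (INR n) ((d + w) / 2)) / 2)) as (u & Hu); [lra|].
      apply (eventual_paths_null fs _ ((r + Rpower (INR n) ((d + w) / 2)) / 2) u); auto;
        [fold n; lia|lra|fold n; lra].
  (* Without a cycle [Lambda] is empty, hence null already for [s = 0], since the empty set has
     weight 0 even for that exponent. *)
  - intros Hnc. split; [easy|]. intros w Hw. apply Hw; [lra|].
    apply hausdorff_null_empty. intros x Hx. destruct (HL x Hx) as (Hx0 & L & HLx).
    apply Hnc. now apply eventual_edges_cycle with x L.
Qed.
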